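(* Let $n$ be a natural number and $0<\sigma_0<2$. There is a constant $C>0$ such that, with $b=C\log t$, as $t\to+\infty$, \[ U(t)=\frac{1}{2\pi i}\int_{-b-i\sigma_0}^{\,b-i\sigma_0} e^{i\vartheta(t+x)-i\vartheta(t)}\,\zeta\bigl(\tfrac12+i(t+x)\bigr)\,\frac{\pi}{2\sinh\frac{\pi x}{2}}\,dx+O(t^{-n}), \] the integral being over the horizontal segment from $-b-i\sigma_0$ to $b-i\sigma_0$ (the implied constant may depend on $n$ and $\sigma_0$).
   Context: $\vartheta$ is the Riemann–Siegel theta function: the holomorphic function on $\mathbb C\setminus(\{iy:y\ge\frac12\}\cup\{iy:y\le-\frac12\})$ with $\vartheta(0)=0$ and $e^{i\vartheta(t)}=\pi^{-it/2}\sqrt{\Gamma(\frac14+\frac{it}{2})/\Gamma(\frac14-\frac{it}{2})}$. $\zeta$ is the Riemann zeta function. For real $t$, \[ U(t)=\frac{1}{2\pi i}\int_{-i\sigma-\infty}^{-i\sigma+\infty} e^{i\vartheta(t+x)-i\vartheta(t)}\,\zeta\bigl(\tfrac12+i(t+x)\bigr)\,\frac{\pi}{2\sinh\frac{\pi x}{2}}\,dx,\qquad 0<\sigma<\tfrac12, \] which is independent of $\sigma\in(0,\frac12)$. *)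

(* Defs.v *)
From Stdlib Require Import Reals Factorial.
From Coquelicot Require Import Coquelicot.
Open Scope R_scope.

Definition cexp (z : C) : C :=
  (exp (Re z) * cos (Im z), exp (Re z) * sin (Im z)).

Definition carg (z : C) : R :=
  if Rlt_dec 0 (Re z) then atan (Im z / Re z)
  else if Rlt_dec (Re z) 0 then
    (if Rle_dec 0 (Im z) then atan (Im z / Re z) + PI
     else atan (Im z / Re z) - PI)
  else if Rlt_dec 0 (Im z) then PI / 2
  else if Rlt_dec (Im z) 0 then - (PI / 2)
  else 0.

Definition clog (z : C) : C := (ln (Cmod z), carg z).

Definition clim (u : nat -> C) : C :=
  (real (Lim_seq (fun n => Re (u n))), real (Lim_seq (fun n => Im (u n)))).

(** Principal branch of log Gamma on C \ (-oo,0], via Gauss' limit formula: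
    log Gamma(z) = lim_n ( ln n! + z ln n - sum_{k=0}^n Log (z+k) ). *)
Definition logGamma (z : C) : C :=
  clim (fun n =>
    (RtoC (ln (INR (fact n))) + z * RtoC (ln (INR n))
     - sum_n (fun k => clog (z + RtoC (INR k))) n)%C).

(** Riemann–Siegel theta function, as a holomorphic function on
    C \ ({iy : y >= 1/2} U {iy : y <= -1/2}):
    theta(t) = (logGamma(1/4 + i t/2) - logGamma(1/4 - i t/2)) / (2i) - (t/2) ln pi.
    It satisfies theta(0) = 0 and
    exp(i theta(t)) = pi^(-it/2) sqrt(Gamma(1/4+it/2)/Gamma(1/4-it/2)). *)
Definition RStheta (t : C) : C :=
  ((logGamma (RtoC (1/4) + Ci * t / RtoC 2)
    - logGamma (RtoC (1/4) - Ci * t / RtoC 2)) / (RtoC 2 * Ci)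
   - t / RtoC 2 * RtoC (ln PI))%C.

Definition rpowC (x : R) (s : C) : C := cexp (s * RtoC (ln x))%C.

(** Riemann zeta function in the half-plane Re s > 0 (s <> 1), by the
    classical continuation
      zeta(s) = s/(s-1) - s * int_1^oo {x} x^(-s-1) dx. *)
Definition zeta (s : C) : C :=
  (s / (s - RtoC 1)
   - s * @RInt_gen C_R_CompleteNormedModule
           (fun x : R => (RtoC (frac_part x) * rpowC x (- s - RtoC 1))%C)
           (at_point 1) (Rbar_locally p_infty))%C.

Definition csinh (z : C) : C := ((cexp z - cexp (- z)) / RtoC 2)%C.

Definition Uintegrand (t : R) (x : C) : C :=
  (cexp (Ci * RStheta (RtoC t + x) - Ci * RStheta (RtoC t))
   * zeta (RtoC (1/2) + Ci * (RtoC t + x))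
   * (RtoC PI / (RtoC 2 * csinh (RtoC PI * x / RtoC 2))))%C.

Definition Uline (sigma t : R) : C :=
  (/ (RtoC (2 * PI) * Ci) *
   @RInt_gen C_R_CompleteNormedModule
     (fun u : R => Uintegrand t (RtoC u - Ci * RtoC sigma))
     (Rbar_locally m_infty) (Rbar_locally p_infty))%C.

(** U(t); the integral is independent of sigma in (0,1/2); we take sigma = 1/4. *)
Definition U (t : R) : C := Uline (1/4) t.

Definition Useg (sigma0 b t : R) : C :=
  (/ (RtoC (2 * PI) * Ci) *
   @RInt C_R_CompleteNormedModule
     (fun u : R => Uintegrand t (RtoC u - Ci * RtoC sigma0)) (- b) b)%C.

(* Main.v *)
Require Import Defs.
From Stdlib Require Import Reals Lra Lia Factorial.
From Coquelicot Require Import Coquelicot.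
Open Scope R_scope.

(** On the line [Im x = -1/4] the integrand is [O(t^2 exp(-|Re x|/2))]: the
    kernel [1/sinh] beats the polynomial growth of [exp(i theta)] and [zeta], so
    cutting the line at [|Re x| = b = 2(n+2) ln t] costs [O(t^-n)].  The segment
    is then moved from height [-1/4] to height [-sigma0]; inside [-2 < Im x < 0],
    [|Re x| <= b < t] the integrand is holomorphic (the pole of zeta sits at
    [x = -t - i/2]), and the vertical sides are as small as the tails.

    The shift is carried out for elementary approximations of the integrand, with
    log Gamma replaced by a term of Gauss' sequence and the integral defining zeta
    cut at an integer.  These are explicitly holomorphic, they satisfy the same
    bounds, and they converge uniformly on segments. *)

(** * Holomorphic functions along paths *)

(** [logGamma] is a limit and [zeta] contains an improper integral, so their holomorphy would
    require differentiation under a limit. The shift avoids this: its estimate involves only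
    integrals over segments and bounds on the vertical sides, and both pass to the limit once the
    bounds are uniform in the approximation index. Stirling's formula is avoided too. Only the
    modulus of exp(i theta) matters, and the Gauss sum pairs the factors of the two Gamma values:
    with h = -Im w / 2 and y = Re w / 2, the k-th pair contributes ln |k+1/4+h+iy| - ln
    |k+1/4-h-iy|, which a telescoping minorant controls uniformly in the number of factors. The
    kernel decays at least like exp(-|Re x|). Half of this rate absorbs the growth of the other
    factors in Re x, leaving t^2 exp(-|Re x|/2); at |Re x| = b this equals t^2 t^(-n-2), which
    explains the n+2 and the factor 2 in b. *)

Lemma C_eq (z w : C) : Re z = Re w -> Im z = Im w -> z = w.
Proof. destruct z, w; simpl; intros; subst; reflexivity. Qed.

Lemma norm_C_R (z : C) : @norm R_AbsRing C_R_NormedModule z = Cmod z.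
Proof.
  unfold norm; simpl; unfold prod_norm, Cmod; f_equal.
  unfold norm; simpl; unfold abs; simpl.
  rewrite !Rmult_1_r, <- !Rabs_mult, !Rabs_pos_eq by apply Rle_0_sqr; reflexivity.
Qed.

Lemma Cmod_le_abs (z : C) : Cmod z <= Rabs (Re z) + Rabs (Im z).
Proof.
  destruct z as [x y]; unfold Cmod; simpl fst; simpl snd; simpl Re; simpl Im.
  rewrite <- (sqrt_Rsqr (Rabs x + Rabs y)) by (pose proof (Rabs_pos x); pose proof (Rabs_pos y); lra).
  apply sqrt_le_1_alt; unfold Rsqr.
  pose proof (Rabs_pos x); pose proof (Rabs_pos y).
  rewrite <- (pow2_abs x), <- (pow2_abs y); nra.
Qed.

Lemma im_le_Cmod (z : C) : Rabs (Im z) <= Cmod z.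
Proof. eapply Rle_trans; [apply Rmax_r | apply (Rmax_Cmod z)]. Qed.

(** Componentwise, so that each differentiation rule reduces to two real derivatives within reach of
    [auto_derive]. *)
Definition cderive (g : R -> C) (r : R) (d : C) : Prop :=
  is_derive (fun r => Re (g r)) r (Re d) /\ is_derive (fun r => Im (g r)) r (Im d).

Definition ccont (f : C -> C) (z : C) : Prop :=
  continuous (fun w : C => Re (f w)) z /\ continuous (fun w : C => Im (f w)) z.

(** The derivative is tested along all differentiable real paths, which makes the
    chain rule part of the definition; [f'] is required to be continuous. *)
Definition hol (D : C -> Prop) (f : C -> C) : Prop :=
  exists f' : C -> C, forall z : C, D z ->
    ccont f z /\ ccont f' z /\
    forall g r d, g r = z -> cderive g r d -> cderive (fun r => f (g r)) r (f' z * d)%C.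

Lemma ccont_plus (f g : C -> C) (z : C) : ccont f z -> ccont g z -> ccont (fun z => f z + g z)%C z.
Proof.
  intros [F1 F2] [G1 G2]; split; simpl.
  - exact (continuous_plus (V:=R_NormedModule) _ _ _ F1 G1).
  - exact (continuous_plus (V:=R_NormedModule) _ _ _ F2 G2).
Qed.

Lemma ccont_opp (f : C -> C) (z : C) : ccont f z -> ccont (fun z => - f z)%C z.
Proof.
  intros [F1 F2]; split; simpl.
  - exact (continuous_opp (V:=R_NormedModule) _ _ F1).
  - exact (continuous_opp (V:=R_NormedModule) _ _ F2).
Qed.

Lemma ccont_mult (f g : C -> C) (z : C) : ccont f z -> ccont g z -> ccont (fun z => f z * g z)%C z.
Proof.
  intros [F1 F2] [G1 G2]; split; simpl.
  - exact (continuous_minus (V:=R_NormedModule) _ _ _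
      (continuous_mult (K:=R_AbsRing) _ _ _ F1 G1) (continuous_mult (K:=R_AbsRing) _ _ _ F2 G2)).
  - exact (continuous_plus (V:=R_NormedModule) _ _ _
      (continuous_mult (K:=R_AbsRing) _ _ _ F1 G2) (continuous_mult (K:=R_AbsRing) _ _ _ F2 G1)).
Qed.

Lemma ccont_const c z : ccont (fun _ => c) z.
Proof. split; apply continuous_const. Qed.

Lemma C_neq0_sq (z : C) : z <> 0%C -> fst z ^ 2 + snd z ^ 2 <> 0.
Proof.
  intros H E; apply H; destruct z as [x y]; simpl in E.
  apply C_eq; simpl; nra.
Qed.

Lemma ccont_inv (f : C -> C) (z : C) : f z <> 0%C -> ccont f z -> ccont (fun z => / f z)%C z.
Proof.
  intros H0 [F1 F2].
  assert (S : continuous (fun w : C => / (fst (f w) ^ 2 + snd (f w) ^ 2)) z).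
  { apply (continuous_comp (fun w : C => fst (f w) ^ 2 + snd (f w) ^ 2) Rinv).
    - simpl; apply (continuous_plus (V:=R_NormedModule)).
      + apply (continuous_mult (K:=R_AbsRing) _ _ _ F1).
        apply (continuous_mult (K:=R_AbsRing) _ _ _ F1). apply continuous_const.
      + apply (continuous_mult (K:=R_AbsRing) _ _ _ F2).
        apply (continuous_mult (K:=R_AbsRing) _ _ _ F2). apply continuous_const.
    - apply continuous_Rinv, C_neq0_sq, H0. }
  split; simpl.
  - exact (continuous_mult (K:=R_AbsRing) _ _ _ F1 S).
  - exact (continuous_mult (K:=R_AbsRing) _ _ _
      (continuous_opp (V:=R_NormedModule) _ _ F2) S).
Qed.

Lemma ccont_exp (f : C -> C) (z : C) : ccont f z -> ccont (fun z => cexp (f z)) z.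
Proof.
  intros [F1 F2].
  assert (E := continuous_comp _ _ _ F1 (continuous_exp _)).
  split; simpl; apply (continuous_mult (K:=R_AbsRing) _ _ _ E).
  - exact (continuous_comp _ _ _ F2 (continuous_cos _)).
  - exact (continuous_comp _ _ _ F2 (continuous_sin _)).
Qed.

Lemma carg_right (z : C) : 0 < Re z -> carg z = atan (Im z / Re z).
Proof. intros H; unfold carg; destruct (Rlt_dec 0 (Re z)); [reflexivity | lra]. Qed.

(** A single smooth formula across the negative imaginary axis, where the case split in [carg]
    changes branch. *)
Lemma carg_lower (z : C) : Im z < 0 -> carg z = - (PI / 2) - atan (Re z / Im z).
Proof.
  destruct z as [x y]; unfold carg; simpl; intros H.
  destruct (Rlt_dec 0 x) as [Hx|Hx].
  - replace (y / x) with (- / (x / - y)) by (field; lra).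
    replace (x / y) with (- (x / - y)) by (field; lra).
    rewrite !atan_opp, atan_inv; [lra |].
    apply Rdiv_lt_0_compat; lra.
  - destruct (Rlt_dec x 0) as [Hx'|Hx'].
    + destruct (Rle_dec 0 y); [lra |].
      replace (y / x) with (/ (x / y)) by (field; lra).
      rewrite atan_inv; [lra |].
      replace (x / y) with ((- x) / (- y)) by (field; lra).
      apply Rdiv_lt_0_compat; lra.
    + destruct (Rlt_dec 0 y); [lra |]; destruct (Rlt_dec y 0); [| lra].
      replace x with 0 by lra; unfold Rdiv; rewrite Rmult_0_l, atan_0; lra.
Qed.

Lemma locally_gt0 {T : UniformSpace} (f : T -> R) x :
  continuous f x -> 0 < f x -> locally x (fun y => 0 < f y).
Proof. intros H H0; apply (H (fun y => 0 < y)), open_gt, H0. Qed.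

Lemma locally_lt0 {T : UniformSpace} (f : T -> R) x :
  continuous f x -> f x < 0 -> locally x (fun y => f y < 0).
Proof. intros H H0; apply (H (fun y => y < 0)), open_lt, H0. Qed.

(** This part of the plane cut along the negative real axis suffices: 1/4 - iw/2 may enter the left
    half-plane during the shift, but only with negative imaginary part. *)
Definition slit (z : C) : Prop := 0 < Re z \/ Im z < 0.

Lemma slit_neq0 z : slit z -> z <> 0%C.
Proof. intros [H|H] E; rewrite E in H; simpl in H; lra. Qed.

Lemma slit_sq z : slit z -> 0 < fst z ^ 2 + snd z ^ 2.
Proof. destruct z as [x y]; intros [H|H]; simpl in *; nra. Qed.

Lemma continuous_Rdiv {T : UniformSpace} (f g : T -> R) x :
  continuous f x -> continuous g x -> g x <> 0 -> continuous (fun y => f y / g y) x.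
Proof.
  intros F G H; apply (continuous_mult (K:=R_AbsRing) _ _ _ F).
  exact (continuous_comp _ _ _ G (continuous_Rinv _ H)).
Qed.

Lemma continuous_sqrt_ln q : 0 < q -> continuous (fun q => ln (sqrt q)) q.
Proof.
  intros H; apply (ex_derive_continuous (V:=R_NormedModule)); auto_derive.
  pose proof (sqrt_lt_R0 _ H); repeat split; lra.
Qed.

Lemma ccont_log (f : C -> C) (z : C) : slit (f z) -> ccont f z -> ccont (fun z => clog (f z)) z.
Proof.
  intros Hs [F1 F2]; split; simpl.
  - unfold Cmod.
    apply (continuous_comp (fun w : C => fst (f w) ^ 2 + snd (f w) ^ 2) (fun q => ln (sqrt q))).
    + simpl; apply (continuous_plus (V:=R_NormedModule)).
      * apply (continuous_mult (K:=R_AbsRing) _ _ _ F1).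
        apply (continuous_mult (K:=R_AbsRing) _ _ _ F1). apply continuous_const.
      * apply (continuous_mult (K:=R_AbsRing) _ _ _ F2).
        apply (continuous_mult (K:=R_AbsRing) _ _ _ F2). apply continuous_const.
    + apply continuous_sqrt_ln, slit_sq, Hs.
  - destruct Hs as [H|H].
    + apply (continuous_ext_loc _ (fun w => atan (Im (f w) / Re (f w)))).
      * generalize (locally_gt0 _ _ F1 H); apply filter_imp; intros w Hw.
        symmetry; apply carg_right, Hw.
      * apply continuous_comp; [apply continuous_Rdiv; auto; lra | apply continuous_atan].
    + apply (continuous_ext_loc _ (fun w => - (PI / 2) - atan (Re (f w) / Im (f w)))).
      * generalize (locally_lt0 _ _ F2 H); apply filter_imp; intros w Hw.
        symmetry; apply carg_lower, Hw.
      * apply (continuous_minus (V:=R_NormedModule)); [apply continuous_const |].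
        apply continuous_comp; [apply continuous_Rdiv; auto; lra | apply continuous_atan].
Qed.

(** [auto_derive] leaves [Derive] terms for the component functions; they are replaced by the
    derivatives known from the context, and the equation is restated at type [R] for [ring] and
    [field]. *)
Ltac der_side :=
  match goal with |- @eq _ ?a ?b => change (@eq R a b) end;
  repeat match goal with
  | H : is_derive ?f ?r ?l |- context [Derive ?g ?r] =>
      replace (Derive g r) with l by (symmetry; apply is_derive_unique; exact H)
  end.

Lemma is_derive_val (f : R -> R) (r l l' : R) : is_derive f r l' -> l' = l -> is_derive f r l.
Proof. intros H <-; exact H. Qed.

Lemma cderive_plus (g h : R -> C) (r : R) (d e : C) : cderive g r d -> cderive h r e ->
  cderive (fun r => g r + h r)%C r (d + e)%C.
Proof.
  intros [G1 G2] [H1 H2]; split; simpl.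
  - exact (is_derive_plus (V:=R_NormedModule) _ _ _ _ _ G1 H1).
  - exact (is_derive_plus (V:=R_NormedModule) _ _ _ _ _ G2 H2).
Qed.

Lemma cderive_opp (g : R -> C) (r : R) (d : C) : cderive g r d -> cderive (fun r => - g r)%C r (- d)%C.
Proof.
  intros [G1 G2]; split; simpl.
  - exact (is_derive_opp (V:=R_NormedModule) _ _ _ G1).
  - exact (is_derive_opp (V:=R_NormedModule) _ _ _ G2).
Qed.

Lemma cderive_mult (g h : R -> C) (r : R) (d e : C) : cderive g r d -> cderive h r e ->
  cderive (fun r => g r * h r)%C r (d * h r + g r * e)%C.
Proof.
  intros [G1 G2] [H1 H2].
  pose (g1 := fun r => Re (g r)); pose (g2 := fun r => Im (g r)).
  pose (h1 := fun r => Re (h r)); pose (h2 := fun r => Im (h r)).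
  assert (is_derive g1 r (Re d)) by exact G1. assert (is_derive g2 r (Im d)) by exact G2.
  assert (is_derive h1 r (Re e)) by exact H1. assert (is_derive h2 r (Im e)) by exact H2.
  split; simpl.
  - apply (is_derive_ext (fun r => g1 r * h1 r - g2 r * h2 r)); [reflexivity |].
    eapply is_derive_val; [auto_derive; [repeat split; eexists; eassumption | reflexivity] |].
    der_side; unfold g1, g2, h1, h2, Re, Im; ring.
  - apply (is_derive_ext (fun r => g1 r * h2 r + g2 r * h1 r)); [reflexivity |].
    eapply is_derive_val; [auto_derive; [repeat split; eexists; eassumption | reflexivity] |].
    der_side; unfold g1, g2, h1, h2, Re, Im; ring.
Qed.

Lemma cderive_val g r d e : cderive g r d -> d = e -> cderive g r e.
Proof. intros H <-; exact H. Qed.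

Lemma cderive_inv (g : R -> C) (r : R) (d : C) : g r <> 0%C -> cderive g r d ->
  cderive (fun r => / g r)%C r (- (/ g r * / g r) * d)%C.
Proof.
  intros H0 [G1 G2]; apply C_neq0_sq in H0.
  pose (g1 := fun r => Re (g r)); pose (g2 := fun r => Im (g r)).
  assert (is_derive g1 r (Re d)) by exact G1. assert (is_derive g2 r (Im d)) by exact G2.
  change (g1 r ^ 2 + g2 r ^ 2 <> 0) in H0.
  split; simpl.
  - apply (is_derive_ext (fun r => g1 r / (g1 r ^ 2 + g2 r ^ 2))); [reflexivity |].
    eapply is_derive_val.
    { auto_derive; [repeat split; try (eexists; eassumption); exact H0 | reflexivity]. }
    der_side; fold (Re (g r)) (Im (g r)). change (Re (g r)) with (g1 r); change (Im (g r)) with (g2 r).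
    unfold Re, Im; simpl in H0 |- *; field; intro E; apply H0; rewrite <- E; ring.
  - apply (is_derive_ext (fun r => - g2 r / (g1 r ^ 2 + g2 r ^ 2))); [reflexivity |].
    eapply is_derive_val.
    { auto_derive; [repeat split; try (eexists; eassumption); exact H0 | reflexivity]. }
    der_side; fold (Re (g r)) (Im (g r)). change (Re (g r)) with (g1 r); change (Im (g r)) with (g2 r).
    unfold Re, Im; simpl in H0 |- *; field; intro E; apply H0; rewrite <- E; ring.
Qed.

Lemma cderive_exp (g : R -> C) (r : R) (d : C) : cderive g r d -> cderive (fun r => cexp (g r)) r (cexp (g r) * d)%C.
Proof.
  intros [G1 G2].
  pose (g1 := fun r => Re (g r)); pose (g2 := fun r => Im (g r)).
  assert (is_derive g1 r (Re d)) by exact G1. assert (is_derive g2 r (Im d)) by exact G2.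
  split; simpl.
  - apply (is_derive_ext (fun r => exp (g1 r) * cos (g2 r))); [reflexivity |].
    eapply is_derive_val; [auto_derive; [repeat split; eexists; eassumption | reflexivity] |].
    der_side; unfold g1, g2, Re, Im; ring.
  - apply (is_derive_ext (fun r => exp (g1 r) * sin (g2 r))); [reflexivity |].
    eapply is_derive_val; [auto_derive; [repeat split; eexists; eassumption | reflexivity] |].
    der_side; unfold g1, g2, Re, Im; ring.
Qed.

Lemma cderive_log (g : R -> C) (r : R) (d : C) : slit (g r) -> cderive g r d ->
  cderive (fun r => clog (g r)) r (/ g r * d)%C.
Proof.
  intros Hs [G1 G2]. assert (H0 := slit_sq _ Hs).
  pose (g1 := fun r => Re (g r)); pose (g2 := fun r => Im (g r)).
  assert (A1 : is_derive g1 r (Re d)) by exact G1. assert (A2 : is_derive g2 r (Im d)) by exact G2.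
  change (0 < g1 r ^ 2 + g2 r ^ 2) in H0.
  assert (C1 : continuous g1 r) by (apply (ex_derive_continuous (V:=R_NormedModule)); eexists; exact A1).
  assert (C2 : continuous g2 r) by (apply (ex_derive_continuous (V:=R_NormedModule)); eexists; exact A2).
  split; simpl.
  - apply (is_derive_ext (fun r => ln (sqrt (g1 r ^ 2 + g2 r ^ 2)))); [reflexivity |].
    assert (Hq := sqrt_lt_R0 _ H0).
    assert (Hq2 := sqrt_sqrt _ (Rlt_le _ _ H0)).
    eapply is_derive_val.
    { auto_derive; [repeat split; try (eexists; eassumption) | reflexivity].
      - simpl in H0; exact H0. - simpl in Hq; exact Hq. }
    (* Writing the squared modulus as q * q, with q the modulus, turns the goal into a rational
       identity. *)
    der_side. change (fst (g r)) with (g1 r); change (snd (g r)) with (g2 r).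
    simpl in Hq, Hq2, H0 |- *. revert Hq Hq2; set (q := sqrt _); intros Hq Hq2.
    unfold Re, Im. rewrite <- !Hq2. field; lra.
  - destruct Hs as [H|H].
    + change (0 < g1 r) in H.
      apply (is_derive_ext_loc (fun r => atan (g2 r / g1 r))).
      { generalize (locally_gt0 _ _ C1 H); apply filter_imp; intros w Hw; symmetry; apply carg_right, Hw. }
      eapply is_derive_val.
      { auto_derive; [repeat split; try (eexists; eassumption); lra | reflexivity]. }
      der_side. change (fst (g r)) with (g1 r); change (snd (g r)) with (g2 r).
      simpl in H0 |- *. unfold Re, Im. field. repeat split; nra.
    + change (g2 r < 0) in H.
      apply (is_derive_ext_loc (fun r => - (PI / 2) - atan (g1 r / g2 r))).
      { generalize (locally_lt0 _ _ C2 H); apply filter_imp; intros w Hw; symmetry; apply carg_lower, Hw. }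
      eapply is_derive_val.
      { auto_derive; [repeat split; try (eexists; eassumption); lra | reflexivity]. }
      der_side. change (fst (g r)) with (g1 r); change (snd (g r)) with (g2 r).
      simpl in H0 |- *. unfold Re, Im. field. repeat split; nra.
Qed.

Lemma hol_const D c : hol D (fun _ => c).
Proof.
  exists (fun _ => 0%C); intros z _; split; [| split].
  - apply ccont_const.
  - apply ccont_const.
  - intros g r d _ _; eapply cderive_val; [| symmetry; apply Cmult_0_l].
    split; apply (is_derive_const (V:=R_NormedModule)).
Qed.

Lemma hol_id D : hol D (fun z => z).
Proof.
  exists (fun _ => 1%C); intros z _; split; [| split].
  - split; [apply continuous_fst | apply continuous_snd].
  - apply ccont_const.
  - intros g r d _ H; eapply cderive_val; [exact H | symmetry; apply Cmult_1_l].
Qed.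

Lemma hol_plus (D : C -> Prop) (f g : C -> C) : hol D f -> hol D g -> hol D (fun z => f z + g z)%C.
Proof.
  intros [f' Hf] [g' Hg]; exists (fun z => f' z + g' z)%C; intros z Hz.
  destruct (Hf z Hz) as (F1 & F2 & F3), (Hg z Hz) as (G1 & G2 & G3).
  split; [| split]; try (apply ccont_plus; assumption).
  intros c r d Hc Hd; eapply cderive_val; [apply cderive_plus; [apply F3 | apply G3]; eassumption |].
  ring.
Qed.

Lemma hol_opp (D : C -> Prop) (f : C -> C) : hol D f -> hol D (fun z => - f z)%C.
Proof.
  intros [f' Hf]; exists (fun z => - f' z)%C; intros z Hz.
  destruct (Hf z Hz) as (F1 & F2 & F3).
  split; [| split]; try (apply ccont_opp; assumption).
  intros c r d Hc Hd; eapply cderive_val; [apply cderive_opp, F3; eassumption |].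
  ring.
Qed.

Lemma hol_minus (D : C -> Prop) (f g : C -> C) : hol D f -> hol D g -> hol D (fun z => f z - g z)%C.
Proof. intros F G; apply (hol_plus D f (fun z => - g z)%C F), hol_opp, G. Qed.

Lemma hol_mult (D : C -> Prop) (f g : C -> C) : hol D f -> hol D g -> hol D (fun z => f z * g z)%C.
Proof.
  intros [f' Hf] [g' Hg]; exists (fun z => f' z * g z + f z * g' z)%C; intros z Hz.
  destruct (Hf z Hz) as (F1 & F2 & F3), (Hg z Hz) as (G1 & G2 & G3).
  split; [| split].
  - apply ccont_mult; assumption.
  - apply ccont_plus; apply ccont_mult; assumption.
  - intros c r d Hc Hd; eapply cderive_val; [apply cderive_mult; [apply F3 | apply G3]; eassumption |].
    simpl; rewrite Hc; ring.
Qed.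

Lemma hol_inv (D : C -> Prop) (f : C -> C) : (forall z, D z -> f z <> 0%C) -> hol D f -> hol D (fun z => / f z)%C.
Proof.
  intros H0 [f' Hf]; exists (fun z => - (/ f z * / f z) * f' z)%C; intros z Hz.
  destruct (Hf z Hz) as (F1 & F2 & F3).
  assert (I := ccont_inv f z (H0 z Hz) F1).
  split; [| split]; [exact I | |].
  - apply ccont_mult; [apply ccont_opp, ccont_mult; exact I | exact F2].
  - intros c r d Hc Hd; eapply cderive_val.
    + apply cderive_inv; [rewrite Hc; apply H0, Hz | apply F3; eassumption].
    + simpl; rewrite Hc; ring.
Qed.

Lemma hol_div (D : C -> Prop) (f g : C -> C) : (forall z, D z -> g z <> 0%C) -> hol D f -> hol D g ->
  hol D (fun z => f z / g z)%C.
Proof. intros H F G; apply (hol_mult D f (fun z => / g z)%C F), hol_inv; assumption. Qed.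

Lemma hol_exp (D : C -> Prop) (f : C -> C) : hol D f -> hol D (fun z => cexp (f z)).
Proof.
  intros [f' Hf]; exists (fun z => cexp (f z) * f' z)%C; intros z Hz.
  destruct (Hf z Hz) as (F1 & F2 & F3).
  assert (I := ccont_exp f z F1).
  split; [| split]; [exact I | apply ccont_mult; assumption |].
  intros c r d Hc Hd; eapply cderive_val; [apply cderive_exp, F3; eassumption |].
  simpl; rewrite Hc; ring.
Qed.

Lemma hol_log (D : C -> Prop) (f : C -> C) : (forall z, D z -> slit (f z)) -> hol D f -> hol D (fun z => clog (f z)).
Proof.
  intros H0 [f' Hf]; exists (fun z => / f z * f' z)%C; intros z Hz.
  destruct (Hf z Hz) as (F1 & F2 & F3).
  split; [| split].
  - apply ccont_log; auto.
  - apply ccont_mult; [apply ccont_inv; auto; apply slit_neq0; auto | exact F2].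
  - intros c r d Hc Hd; eapply cderive_val.
    + apply cderive_log; [rewrite Hc; apply H0, Hz | apply F3; eassumption].
    + simpl; rewrite Hc; ring.
Qed.

Lemma hol_ext (D : C -> Prop) (f g : C -> C) : (forall z, f z = g z) -> hol D f -> hol D g.
Proof.
  intros E [f' Hf]; exists f'; intros z Hz.
  destruct (Hf z Hz) as ([F1 F1'] & F2 & F3).
  split; [| split; [exact F2 |]].
  - split; [eapply continuous_ext; [| exact F1] | eapply continuous_ext; [| exact F1']];
      intros w; simpl; rewrite E; reflexivity.
  - intros c r d Hc Hd; destruct (F3 c r d Hc Hd) as [D1 D2].
    split; [eapply is_derive_ext; [| exact D1] | eapply is_derive_ext; [| exact D2]];
      intros w; simpl; rewrite E; reflexivity.
Qed.

Lemma hol_sum_n D (f : nat -> C -> C) n : (forall k, (k <= n)%nat -> hol D (f k)) ->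
  hol D (fun z => sum_n (fun k => f k z) n).
Proof.
  induction n as [|n IH]; intros H.
  - apply (hol_ext D (f 0%nat)); [| apply H; lia].
    intros z; rewrite sum_O; reflexivity.
  - apply (hol_ext D (fun z => sum_n (fun k => f k z) n + f (S n) z)%C).
    + intros z; rewrite sum_Sn; reflexivity.
    + apply hol_plus; [apply IH; intros; apply H; lia | apply H; lia].
Qed.

(** * Moving a horizontal segment *)

Lemma continuity_2d_continuous (g : R -> R -> R) s u :
  continuity_2d_pt g s u -> continuous (g s) u.
Proof.
  intros H P [eps HP]; destruct (H eps) as [del Hd]; exists del; intros v Hv.
  apply HP, Hd; [rewrite Rminus_diag, Rabs_R0; apply cond_pos | exact Hv].
Qed.

(** If [d phi / ds = d psi / du] then the [s]-derivative of [int_a^b phi s u du] is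
    the boundary term [psi s b - psi s a]; for the real and imaginary parts of a
    holomorphic function this is Cauchy's theorem on a thin rectangle. *)
Lemma RInt_param_shift (phi psi g : R -> R -> R) (a0 a b b0 lo hi M s1 s2 : R) :
  a0 < a -> a <= b -> b < b0 -> lo < s1 < hi -> lo < s2 < hi ->
  (forall s u, lo < s < hi -> a0 < u < b0 -> is_derive (fun s => phi s u) s (g s u)) ->
  (forall s u, lo < s < hi -> a0 < u < b0 -> is_derive (psi s) u (g s u)) ->
  (forall s u, lo < s < hi -> a0 < u < b0 -> continuity_2d_pt g s u) ->
  (forall s u, lo < s < hi -> a0 < u < b0 -> continuous (phi s) u) ->
  (forall s, Rmin s1 s2 <= s <= Rmax s1 s2 -> Rabs (psi s a) <= M /\ Rabs (psi s b) <= M) ->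
  Rabs (RInt (phi s2) a b - RInt (phi s1) a b) <= 2 * M * Rabs (s2 - s1).
Proof.
  intros Ha Hab Hb H1 H2 Dphi Dpsi Cg Cphi HM.
  assert (Hloc : forall s, lo < s < hi -> locally s (fun s => lo < s < hi)).
  { intros s Hs; apply (open_and _ _ (open_gt lo) (open_lt hi)); exact Hs. }
  assert (D : forall s, lo < s < hi ->
     is_derive (fun s => RInt (fun u => phi s u) a b) s (psi s b - psi s a)).
  { intros s Hs.
    eapply is_derive_val; [apply is_derive_RInt_param |].
    - generalize (Hloc s Hs); apply filter_imp; intros r Hr u Hu.
      rewrite Rmin_left, Rmax_right in Hu by lra.
      eexists; apply Dphi; lra.
    - intros u Hu; rewrite Rmin_left, Rmax_right in Hu by lra.
      apply (continuity_2d_pt_ext_loc g); [| apply Cg; lra].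
      (* [Derive] agrees with [g] only inside the open rectangle, so the radius is the least
         distance to its sides; hence the strict [a0 < a] and [b < b0]. *)
      assert (Hd : 0 < Rmin (Rmin (s - lo) (hi - s)) (Rmin (u - a0) (b0 - u))).
      { repeat apply Rmin_glb_lt; lra. }
      exists (mkposreal _ Hd); simpl; intros r v Hr Hv.
      symmetry; apply is_derive_unique, Dphi.
      + apply Rmin_Rgt_l in Hr as [Hr _]; apply Rmin_Rgt_l in Hr as [A B].
        apply Rabs_def2 in A; apply Rabs_def2 in B; lra.
      + apply Rmin_Rgt_l in Hv as [_ Hv]; apply Rmin_Rgt_l in Hv as [A B].
        apply Rabs_def2 in A; apply Rabs_def2 in B; lra.
    - generalize (Hloc s Hs); apply filter_imp; intros r Hr.
      apply (ex_RInt_continuous (V:=R_CompleteNormedModule)).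
      intros u Hu; rewrite Rmin_left, Rmax_right in Hu by lra.
      apply Cphi; lra.
    - rewrite (RInt_ext _ (g s)).
      + apply is_RInt_unique.
        apply (is_RInt_derive (V:=R_CompleteNormedModule) (psi s) (g s)).
        * intros u Hu; rewrite Rmin_left, Rmax_right in Hu by lra; apply Dpsi; lra.
        * intros u Hu; rewrite Rmin_left, Rmax_right in Hu by lra.
          apply continuity_2d_continuous, Cg; lra.
      + intros u Hu; rewrite Rmin_left, Rmax_right in Hu by lra.
        apply is_derive_unique, Dphi; lra. }
  assert (Hbt : forall s, Rmin s1 s2 <= s <= Rmax s1 s2 -> lo < s < hi).
  { intros s [A B]; split.
    - eapply Rlt_le_trans; [| exact A]; apply Rmin_glb_lt; lra.
    - eapply Rle_lt_trans; [exact B |]; apply Rmax_lub_lt; lra. }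
  (* By the mean value theorem the difference of the integrals is [s2 - s1] times one boundary term,
     which is at most 2M. *)
  destruct (MVT_gen (fun s => RInt (fun u => phi s u) a b) s1 s2 (fun s => psi s b - psi s a))
    as (c & Hc & E).
  - intros s Hs; apply D, Hbt; lra.
  - intros s Hs; apply derivable_continuous_pt.
    eexists; apply is_derive_Reals; apply D, Hbt, Hs.
  - simpl in E; change (fun u => phi s2 u) with (phi s2) in E.
    change (fun u => phi s1 u) with (phi s1) in E.
    rewrite E, Rabs_mult; apply Rmult_le_compat_r; [apply Rabs_pos |].
    destruct (HM c Hc) as [A B].
    unfold Rminus; eapply Rle_trans; [apply Rabs_triang |]; rewrite Rabs_Ropp; lra.
Qed.

Lemma is_derive_cst (c r l : R) : l = 0 -> is_derive (fun _ : R => c) r l.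
Proof. intros ->; apply (is_derive_const (V:=R_NormedModule)). Qed.

(** Depth [s] is measured downwards. The form is convertible with the paths in [Uline] and
    [Useg]. *)
Definition hline (s u : R) : C := (RtoC u - Ci * RtoC s)%C.

Lemma hline_eq s u : hline s u = (u, - s).
Proof. apply C_eq; simpl; ring. Qed.

Lemma ccont_2d (f : C -> C) s u : ccont f (hline s u) ->
  continuity_2d_pt (fun s u => Re (f (hline s u))) s u /\
  continuity_2d_pt (fun s u => Im (f (hline s u))) s u.
Proof.
  intros [F1 F2].
  assert (L : continuous (fun z : R * R => hline (fst z) (snd z)) (s, u)).
  { apply (continuous_ext (fun z : R * R => (snd z, - fst z))).
    - intros z; symmetry; apply hline_eq.
    - apply (continuous_comp_2 (fun z : R * R => snd z) (fun z : R * R => - fst z) (fun x y => (x, y))).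
      + apply continuous_snd.
      + apply (continuous_opp (V:=R_NormedModule)), continuous_fst.
      + apply (continuous_ext (fun z => z)); [intros [x y]; reflexivity | apply continuous_id]. }
  split; apply continuity_2d_pt_filterlim.
  - exact (continuous_comp (fun z : R * R => hline (fst z) (snd z)) (fun w => Re (f w)) (s, u) L F1).
  - exact (continuous_comp (fun z : R * R => hline (fst z) (snd z)) (fun w => Im (f w)) (s, u) L F2).
Qed.

Lemma is_RInt_C (f : R -> C) a b (l : C) :
  is_RInt (V:=C_R_NormedModule) f a b l <->
  is_RInt (fun u => Re (f u)) a b (Re l) /\ is_RInt (fun u => Im (f u)) a b (Im l).
Proof.
  split.
  - intros H; split.
    + exact (is_RInt_fct_extend_fst (U:=R_NormedModule) (V:=R_NormedModule) f a b l H).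
    + exact (is_RInt_fct_extend_snd (U:=R_NormedModule) (V:=R_NormedModule) f a b l H).
  - intros [H1 H2]; destruct l as [l1 l2].
    exact (is_RInt_fct_extend_pair (U:=R_NormedModule) (V:=R_NormedModule) f a b l1 l2 H1 H2).
Qed.

(** Along [hline], df/ds = -i f' and df/du = f'. So [RInt_param_shift] applies to the pair (Re f, Im
    f) with common derivative Im f', and to (Im f, -Re f) with -Re f'. Each pair costs 2M, whence
    4M. *)
Lemma hol_shift (D : C -> Prop) (f : C -> C) (a0 a b b0 lo hi M s1 s2 : R) (I1 I2 : C) :
  a0 < a -> a <= b -> b < b0 -> lo < s1 < hi -> lo < s2 < hi ->
  (forall s u, lo < s < hi -> a0 < u < b0 -> D (hline s u)) ->
  hol D f ->
  (forall s, Rmin s1 s2 <= s <= Rmax s1 s2 ->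
     Cmod (f (hline s a)) <= M /\ Cmod (f (hline s b)) <= M) ->
  is_RInt (V:=C_R_NormedModule) (fun u => f (hline s1 u)) a b I1 ->
  is_RInt (V:=C_R_NormedModule) (fun u => f (hline s2 u)) a b I2 ->
  Cmod (I2 - I1)%C <= 4 * M * Rabs (s2 - s1).
Proof.
  intros Ha Hab Hb H1 H2 HD [f' Hf] HM J1 J2.
  apply is_RInt_C in J1; apply is_RInt_C in J2.
  destruct J1 as [J1 K1], J2 as [J2 K2].
  assert (Ds : forall s u, lo < s < hi -> a0 < u < b0 ->
    cderive (fun s => f (hline s u)) s (f' (hline s u) * - Ci)%C).
  { intros s u Hs Hu; apply (Hf _ (HD s u Hs Hu)); [reflexivity |]; split.
    - apply (is_derive_ext (fun _ => u)); [intros r; rewrite hline_eq; reflexivity |].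
      apply is_derive_cst; simpl; ring.
    - apply (is_derive_ext (fun s => - s)); [intros r; rewrite hline_eq; reflexivity |].
      eapply is_derive_val; [auto_derive; reflexivity | unfold Re, Im; simpl; ring]. }
  assert (Du : forall s u, lo < s < hi -> a0 < u < b0 ->
    cderive (fun u => f (hline s u)) u (f' (hline s u) * 1)%C).
  { intros s u Hs Hu; apply (Hf _ (HD s u Hs Hu)); [reflexivity |]; split.
    - apply (is_derive_ext (fun r => r)); [intros r; rewrite hline_eq; reflexivity |].
      eapply is_derive_val; [auto_derive; reflexivity | unfold Re, Im; simpl; ring].
    - apply (is_derive_ext (fun r => - s)); [intros r; rewrite hline_eq; reflexivity |].
      apply is_derive_cst; simpl; ring. }
  eapply Rle_trans; [apply Cmod_le_abs |].
  replace (4 * M * Rabs (s2 - s1)) with (2 * M * Rabs (s2 - s1) + 2 * M * Rabs (s2 - s1)) by ring.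
  apply Rplus_le_compat.
  - change (Re (I2 - I1)%C) with (Re I2 - Re I1).
    rewrite <- (is_RInt_unique _ _ _ _ J1), <- (is_RInt_unique _ _ _ _ J2).
    apply (RInt_param_shift (fun s u => Re (f (hline s u))) (fun s u => Im (f (hline s u)))
             (fun s u => Im (f' (hline s u))) a0 a b b0 lo hi M s1 s2); auto.
    + intros s u Hs Hu; eapply is_derive_val; [exact (proj1 (Ds s u Hs Hu)) | unfold Re, Im; simpl; ring].
    + intros s u Hs Hu; eapply is_derive_val; [exact (proj2 (Du s u Hs Hu)) | unfold Re, Im; simpl; ring].
    + intros s u Hs Hu; apply ccont_2d, (Hf _ (HD s u Hs Hu)).
    + intros s u Hs Hu; apply (ex_derive_continuous (V:=R_NormedModule)).
      eexists; exact (proj1 (Du s u Hs Hu)).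
    + intros s Hs; destruct (HM s Hs); split; (eapply Rle_trans; [apply im_le_Cmod |]); assumption.
  - change (Im (I2 - I1)%C) with (Im I2 - Im I1).
    rewrite <- (is_RInt_unique _ _ _ _ K1), <- (is_RInt_unique _ _ _ _ K2).
    apply (RInt_param_shift (fun s u => Im (f (hline s u))) (fun s u => - Re (f (hline s u)))
             (fun s u => - Re (f' (hline s u))) a0 a b b0 lo hi M s1 s2); auto.
    + intros s u Hs Hu; eapply is_derive_val; [exact (proj2 (Ds s u Hs Hu)) | unfold Re, Im; simpl; ring].
    + intros s u Hs Hu.
      eapply is_derive_val; [exact (is_derive_opp (V:=R_NormedModule) _ _ _ (proj1 (Du s u Hs Hu))) | unfold opp, Re, Im; simpl; ring].
    + intros s u Hs Hu; apply continuity_2d_pt_opp, ccont_2d, (Hf _ (HD s u Hs Hu)).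
    + intros s u Hs Hu; apply (ex_derive_continuous (V:=R_NormedModule)).
      eexists; exact (proj2 (Du s u Hs Hu)).
    + intros s Hs; rewrite !Rabs_Ropp.
      destruct (HM s Hs); split; (eapply Rle_trans; [apply re_le_Cmod |]); assumption.
Qed.

Lemma hol_continuous_line (D : C -> Prop) (f : C -> C) s u :
  hol D f -> D (hline s u) -> continuous (U:=C_R_NormedModule) (fun u => f (hline s u)) u.
Proof.
  intros [f' Hf] HD; destruct (Hf _ HD) as (F & _).
  destruct (ccont_2d f s u F) as [F1 F2].
  apply continuity_2d_continuous in F1; apply continuity_2d_continuous in F2.
  apply (continuous_ext (fun v => (Re (f (hline s v)), Im (f (hline s v)))));
    [intros v; destruct (f (hline s v)); reflexivity |].
  apply (continuous_comp_2 _ _ (fun x y : R => (x, y)) u F1 F2).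
  apply (continuous_ext (fun z => z)); [intros [x y]; reflexivity | apply continuous_id].
Qed.

(** * Truncating the integral of zeta *)

Lemma ball_C_Cmod (z w : C) (eps : posreal) :
  Cmod (w - z)%C < eps -> ball (M:=C_UniformSpace) z eps w.
Proof.
  intros H; split.
  - eapply Rle_lt_trans; [| exact H]; exact (re_le_Cmod (w - z)%C).
  - eapply Rle_lt_trans; [| exact H]; exact (im_le_Cmod (w - z)%C).
Qed.

(** Balls of the product uniform structure are squares; adding the two coordinates gives the factor
    2. *)
Lemma Cmod_ball_C (z w : C) (eps : posreal) :
  ball (M:=C_UniformSpace) z eps w -> Cmod (w - z)%C < 2 * eps.
Proof.
  intros [H1 H2]; eapply Rle_lt_trans; [apply Cmod_le_abs |].
  change (Rabs (Re w - Re z) < eps) in H1; change (Rabs (Im w - Im z) < eps) in H2.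
  change (Rabs (Re w - Re z) + Rabs (Im w - Im z) < 2 * eps); lra.
Qed.

Lemma Cmod_minus_sym (z w : C) : Cmod (z - w)%C = Cmod (w - z)%C.
Proof. rewrite <- Cmod_opp; f_equal; ring. Qed.

Lemma Cmod_minus_triangle (x y z : C) : Cmod (x - z)%C <= Cmod (x - y)%C + Cmod (y - z)%C.
Proof. replace (x - z)%C with ((x - y) + (y - z))%C by ring; apply Cmod_triangle. Qed.

Lemma Cplus_minus_l (a b : C) : (a + b - a)%C = b.
Proof. ring. Qed.

Lemma Cminus_0_r (a : C) : (a - RtoC 0)%C = a.
Proof. ring. Qed.

Notation RIntC := (@RInt C_R_CompleteNormedModule).
Notation ex_RIntC := (@ex_RInt C_R_NormedModule).
Notation is_RIntC := (@is_RInt C_R_NormedModule).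

Lemma RIntC_point (f : R -> C) (a : R) : RIntC f a a = RtoC 0.
Proof. apply (RInt_point (V:=C_R_CompleteNormedModule)). Qed.

Lemma RIntC_Chasles (f : R -> C) (a b c : R) : ex_RIntC f a b -> ex_RIntC f b c ->
  RIntC f a c = (RIntC f a b + RIntC f b c)%C.
Proof. intros H K; symmetry; exact (RInt_Chasles (V:=C_R_CompleteNormedModule) f a b c H K). Qed.

(** [RInt_gen] says something only when the limit exists. The second hypothesis is a Cauchy
    criterion whose centre may depend on [eps]; any eventual bound [tau] then passes to the
    limit. *)
Lemma RInt_gen_approx (f : R -> C) (Fa Fb : (R -> Prop) -> Prop)
  {PFa : ProperFilter Fa} {PFb : ProperFilter Fb} :
  filter_prod Fa Fb (fun ab => ex_RIntC f (fst ab) (snd ab)) ->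
  (forall eps : posreal, exists c : C,
     filter_prod Fa Fb (fun ab => Cmod (RIntC f (fst ab) (snd ab) - c)%C < eps)) ->
  forall (c : C) (tau : R),
  filter_prod Fa Fb (fun ab => Cmod (RIntC f (fst ab) (snd ab) - c)%C <= tau) ->
  Cmod (@RInt_gen C_R_CompleteNormedModule f Fa Fb - c)%C <= tau.
Proof.
  intros Hex Hc c tau Ht.
  (* [is_RInt] is a relation, so this criterion also asks for existence and uniqueness of its value;
     existence is [Hex]. *)
  destruct (proj1 (filterlimi_locally_cauchy (U:=C_R_CompleteNormedModule) (F:=filter_prod Fa Fb)
     (fun ab => is_RIntC f (fst ab) (snd ab))
     (filter_imp _ _ (fun ab H => conj H (fun y1 y2 h1 h2 =>
        eq_trans (eq_sym (is_RInt_unique (V:=C_R_CompleteNormedModule) _ _ _ _ h1))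
                 (is_RInt_unique (V:=C_R_CompleteNormedModule) _ _ _ _ h2))) Hex))) as [y Hy].
  { intros eps; destruct (Hc (pos_div_2 eps)) as [d Hd].
    eexists; split; [exact Hd |]; simpl; intros u v Hu Hv u' v' Iu Iv.
    apply (is_RInt_unique (V:=C_R_CompleteNormedModule)) in Iu; apply (is_RInt_unique (V:=C_R_CompleteNormedModule)) in Iv.
    rewrite Iu in Hu; rewrite Iv in Hv.
    apply ball_C_Cmod; eapply Rle_lt_trans; [apply (Cmod_minus_triangle _ d) |].
    rewrite (Cmod_minus_sym d); lra. }
  assert (E : RInt_gen (V:=C_R_CompleteNormedModule) f Fa Fb = y) by (apply is_RInt_gen_unique; exact Hy).
  rewrite E; apply le_epsilon; intros e He.
  assert (He2 : 0 < e / 2) by lra.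
  assert (Hb := proj1 (filterlimi_locally (U:=C_R_CompleteNormedModule) _ y) Hy (mkposreal _ He2)).
  (* The filters are proper, so some pair of bounds has its integral close to the limit and within
     [tau] of [c] at once. *)
  destruct (filter_ex _ (filter_and _ _ Hb Ht)) as (ab & (z & Iz & Bz) & Hz).
  rewrite (is_RInt_unique (V:=C_R_CompleteNormedModule) _ _ _ _ Iz) in Hz.
  apply Cmod_ball_C in Bz; simpl in Bz.
  eapply Rle_trans; [apply (Cmod_minus_triangle _ z) |].
  rewrite (Cmod_minus_sym y); lra.
Qed.

Lemma is_RInt_cderive (F f : R -> C) a b : a <= b ->
  (forall x, a <= x <= b -> cderive F x (f x)) ->
  (forall x, a <= x <= b -> exists d, cderive f x d) ->
  is_RIntC f a b (F b - F a)%C.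
Proof.
  intros Hab HF Hf; apply is_RInt_C; split.
  - apply (is_RInt_derive (V:=R_CompleteNormedModule) (fun x => Re (F x)) (fun x => Re (f x)));
      intros x Hx; rewrite Rmin_left, Rmax_right in Hx by lra.
    + apply HF, Hx.
    + destruct (Hf x Hx) as [d [Hd _]]; apply (ex_derive_continuous (V:=R_NormedModule)); eexists; exact Hd.
  - apply (is_RInt_derive (V:=R_CompleteNormedModule) (fun x => Im (F x)) (fun x => Im (f x)));
      intros x Hx; rewrite Rmin_left, Rmax_right in Hx by lra.
    + apply HF, Hx.
    + destruct (Hf x Hx) as [d [_ Hd]]; apply (ex_derive_continuous (V:=R_NormedModule)); eexists; exact Hd.
Qed.

Lemma cexp_plus z w : cexp (z + w)%C = (cexp z * cexp w)%C.
Proof.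
  apply C_eq; unfold cexp; simpl; fold (Re z) (Re w) (Im z) (Im w); rewrite exp_plus.
  - rewrite cos_plus; ring.
  - rewrite sin_plus; ring.
Qed.

Lemma Cmod_cexp z : Cmod (cexp z) = exp (Re z).
Proof.
  unfold Cmod, cexp; simpl fst; simpl snd.
  replace (_ + _) with (Rsqr (exp (Re z))).
  - apply sqrt_Rsqr, Rlt_le, exp_pos.
  - pose proof (sin2_cos2 (Im z)); unfold Rsqr in *; nra.
Qed.

Lemma Cmod_rpowC (x : R) (s : C) : Cmod (rpowC x s) = exp (Re s * ln x).
Proof. unfold rpowC; rewrite Cmod_cexp; f_equal; simpl; unfold Re; ring. Qed.

Lemma rpowC_pred (x : R) (s : C) : 0 < x -> (RtoC x * rpowC x (s - 1))%C = rpowC x s.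
Proof.
  intros Hx; unfold rpowC.
  replace (s * RtoC (ln x))%C with (RtoC (ln x) + (s - 1) * RtoC (ln x))%C by ring.
  rewrite cexp_plus; f_equal.
  apply C_eq; simpl; rewrite exp_ln by assumption; [rewrite cos_0 | rewrite sin_0]; ring.
Qed.

Lemma cderive_const c r : cderive (fun _ => c) r 0%C.
Proof. split; [exact (is_derive_cst (Re c) r 0 eq_refl) | exact (is_derive_cst (Im c) r 0 eq_refl)]. Qed.

Lemma cderive_RtoC (f : R -> R) (r l : R) : is_derive f r l -> cderive (fun r => RtoC (f r)) r (RtoC l).
Proof. intros H; split; [exact H | exact (is_derive_cst 0 r 0 eq_refl)]. Qed.

Lemma cderive_rpowC (s : C) (x : R) : 0 < x -> cderive (fun x => rpowC x s) x (s * rpowC x (s - 1))%C.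
Proof.
  intros Hx; unfold rpowC at 1.
  eapply cderive_val.
  - apply cderive_exp, (cderive_mult (fun _ => s) (fun r => RtoC (ln r)));
      [apply cderive_const | apply cderive_RtoC, is_derive_ln, Hx].
  - cbv beta; fold (rpowC x s); rewrite <- (rpowC_pred x s) by exact Hx.
    transitivity (s * (RtoC x * RtoC (/ x)) * rpowC x (s - 1))%C; [ring |].
    rewrite <- RtoC_mult, Rinv_r by lra; ring.
Qed.

Definition zeta_fun (s : C) (x : R) : C := (RtoC (frac_part x) * rpowC x (- s - RtoC 1))%C.

(** Antiderivative of [(x - k) x^(-s-1)]. *)
Definition zeta_prim (k : R) (s : C) (x : R) : C :=
  (rpowC x (1 - s) / (1 - s) + RtoC k / s * rpowC x (- s))%C.

(** Between consecutive integers the fractional part is x - k, and the integrand has the elementary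
    primitive [zeta_prim]. *)
Lemma is_RInt_zeta_piece (k : nat) (s : C) (x : R) : (1 <= k)%nat -> s <> 0%C -> s <> 1%C ->
  INR k <= x <= INR k + 1 ->
  is_RIntC (zeta_fun s) (INR k) x (zeta_prim (INR k) s x - zeta_prim (INR k) s (INR k))%C.
Proof.
  intros Hk H0 H1 Hx; apply le_INR in Hk; simpl in Hk.
  assert (H1' : (1 - s)%C <> 0%C) by (intro E; apply H1; transitivity (1 - (1 - s))%C; [ring | rewrite E; ring]).
  apply (is_RInt_ext (V:=C_R_NormedModule) (fun y => RtoC (y - INR k) * rpowC y (- s - RtoC 1))%C).
  (* Agreement is required only on the open interval, so the jump of the fractional part at k + 1
     does no harm. *)
  - intros y Hy; rewrite Rmin_left, Rmax_right in Hy by lra.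
    unfold zeta_fun; f_equal; f_equal.
    apply (Int_part_frac_part_spec y (Z.of_nat k)); [lra | rewrite <- INR_IZR_INZ; ring].
  - apply is_RInt_cderive; [lra | |]; intros y Hy.
    + eapply cderive_val.
      * apply cderive_plus.
        -- apply (cderive_mult (fun y => rpowC y (1 - s)) (fun _ => / (1 - s))%C);
             [apply cderive_rpowC; lra | apply cderive_const].
        -- apply (cderive_mult (fun _ => RtoC (INR k) / s)%C (fun y => rpowC y (- s)));
             [apply cderive_const | apply cderive_rpowC; lra].
      * replace (1 - s - 1)%C with (- s)%C by ring.
        rewrite <- (rpowC_pred y (- s)) at 1 by lra.
        rewrite RtoC_minus; field; split; assumption.
    + eexists; apply (cderive_mult (fun y => RtoC (y - INR k)) (fun y => rpowC y _)).
      * apply (cderive_RtoC (fun y => y - INR k) y 1); auto_derive; [auto | ring].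
      * apply cderive_rpowC; lra.
Qed.

Lemma ex_RInt_zeta (s : C) (B : R) : s <> 0%C -> s <> 1%C -> 1 <= B -> ex_RIntC (zeta_fun s) 1 B.
Proof.
  intros H0 H1 HB.
  assert (Q : forall j B, 1 <= B <= INR j + 1 -> ex_RIntC (zeta_fun s) 1 B).
  { clear B HB; induction j as [|j IH]; intros B HB.
    - simpl in HB; replace B with 1 by lra; apply ex_RInt_point.
    - destruct (Rle_dec B (INR j + 1)) as [L|L]; [apply IH; lra |].
      apply (ex_RInt_Chasles (V:=C_R_NormedModule) _ 1 (INR j + 1)); [apply IH; pose proof (pos_INR j); lra |].
      rewrite S_INR in HB; rewrite <- S_INR; eexists; apply is_RInt_zeta_piece; auto; [lia | rewrite S_INR; lra]. }
  destruct (INR_unbounded B) as [j Hj]; apply (Q j); lra.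
Qed.

(** [zetaN j] is [zeta] with its integral cut at [j + 1]. *)
Fixpoint zetaN (j : nat) (s : C) : C :=
  match j with
  | O => (s / (s - RtoC 1))%C
  | S j' => (zetaN j' s - s * (zeta_prim (INR j) s (INR (S j)) - zeta_prim (INR j) s (INR j)))%C
  end.

Lemma zetaN_RInt (j : nat) (s : C) : s <> 0%C -> s <> 1%C ->
  zetaN j s = (s / (s - RtoC 1) - s * RIntC (zeta_fun s) 1 (INR (S j)))%C.
Proof.
  intros H0 H1; induction j as [|j IH].
  - simpl; rewrite RIntC_point; ring.
  - cbn [zetaN]; rewrite IH.
    assert (I := is_RInt_zeta_piece (S j) s (INR (S (S j))) ltac:(lia) H0 H1
      ltac:(rewrite (S_INR (S j)); lra)).
    assert (I1 := ex_RInt_zeta s (INR (S j)) H0 H1 ltac:(rewrite S_INR; pose proof (pos_INR j); lra)).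
    rewrite (RIntC_Chasles _ 1 (INR (S j)) (INR (S (S j)))); [| exact I1 | eexists; exact I].
    rewrite (is_RInt_unique (V:=C_R_CompleteNormedModule) _ _ _ _ I); ring.
Qed.

(** The integrand is at most x^(-Re s - 1) in modulus, whose integral from A to B is (A^(-Re s) -
    B^(-Re s)) / Re s. Powers are written exp(- Re s * ln A). *)
Lemma zeta_tail (s : C) (A B : R) : 0 < Re s -> s <> 1%C -> 1 <= A <= B ->
  Cmod (RIntC (zeta_fun s) 1 B - RIntC (zeta_fun s) 1 A)%C <= exp (- Re s * ln A) / Re s.
Proof.
  intros Hr H1 HAB.
  assert (H0 : s <> 0%C) by (intro E; rewrite E in Hr; simpl in Hr; lra).
  assert (EA := ex_RInt_zeta s A H0 H1 ltac:(lra)).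
  assert (EB := ex_RInt_zeta s B H0 H1 ltac:(lra)).
  assert (EAB : ex_RIntC (zeta_fun s) A B).
  { apply (ex_RInt_Chasles (V:=C_R_NormedModule) _ A 1 B); [apply ex_RInt_swap |]; assumption. }
  rewrite (RIntC_Chasles _ 1 A B) by assumption.
  rewrite Cplus_minus_l.
  rewrite <- norm_C_R.
  apply Rle_trans with (exp (- Re s * ln A) / Re s - exp (- Re s * ln B) / Re s).
  2:{ pose proof (exp_pos (- Re s * ln B)).
      assert (0 < exp (- Re s * ln B) / Re s) by (apply Rdiv_lt_0_compat; assumption); lra. }
  apply (norm_RInt_le (V:=C_R_NormedModule) (zeta_fun s) (fun x => exp (- (Re s + 1) * ln x)) A B); [lra | | |].
  - intros x Hx; rewrite norm_C_R; unfold zeta_fun; rewrite Cmod_mult, Cmod_rpowC, Cmod_R.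
    destruct (base_fp x) as [F1 F2]; rewrite Rabs_pos_eq by lra.
    replace (Re (- s - RtoC 1)%C) with (- (Re s + 1)) by (unfold Re; simpl; ring).
    pose proof (exp_pos (- (Re s + 1) * ln x)); nra.
  - apply (RInt_correct (V:=C_R_CompleteNormedModule)), EAB.
  - replace (exp (- Re s * ln A) / Re s - exp (- Re s * ln B) / Re s)
      with (minus (- exp (- Re s * ln B) / Re s) (- exp (- Re s * ln A) / Re s))
      by (unfold minus, plus, opp; simpl; field; lra).
    apply (is_RInt_derive (V:=R_CompleteNormedModule) (fun x => - exp (- Re s * ln x) / Re s));
      intros x Hx; rewrite Rmin_left, Rmax_right in Hx by lra.
    + eapply is_derive_val; [auto_derive; [lra | reflexivity] |].
      replace (- (Re s + 1) * ln x) with (- Re s * ln x + - ln x) by ring.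
      rewrite exp_plus, (exp_Ropp (ln x)), exp_ln by lra.
      simpl; field; lra.
    + apply (ex_derive_continuous (V:=R_NormedModule)); auto_derive; lra.
Qed.

Lemma exp_mult_ln_cv r : 0 < r -> forall eps, 0 < eps -> exists A, 1 <= A /\ exp (- r * ln A) < eps.
Proof.
  (* The maximum with 0 ensures A >= 1; the summand 1 makes the final inequality strict. *)
  intros Hr eps He; exists (exp (Rmax 0 (- ln eps / r + 1))); split.
  - rewrite <- exp_0 at 1; destruct (Rmax_l 0 (- ln eps / r + 1)) as [L|L].
    + left; apply exp_increasing, L.
    + right; rewrite <- L; reflexivity.
  - rewrite ln_exp, <- (exp_ln eps) by exact He; apply exp_increasing.
    rewrite (exp_ln eps) by exact He.
    pose proof (Rmax_r 0 (- ln eps / r + 1)).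
    assert (r * (- ln eps / r + 1) <= r * Rmax 0 (- ln eps / r + 1)) by (apply Rmult_le_compat_l; lra).
    replace (r * (- ln eps / r + 1)) with (- ln eps + r) in H0 by (field; lra); lra.
Qed.

Lemma zeta_fun_RInt_gen (s : C) (A : R) : 0 < Re s -> s <> 1%C -> 1 <= A ->
  Cmod (@RInt_gen C_R_CompleteNormedModule (zeta_fun s) (at_point 1) (Rbar_locally p_infty)
        - RIntC (zeta_fun s) 1 A)%C <= exp (- Re s * ln A) / Re s.
Proof.
  intros Hr H1 HA.
  assert (H0 : s <> 0%C) by (intro E; rewrite E in Hr; simpl in Hr; lra).
  assert (Q : forall M, 1 <= M -> filter_prod (at_point 1) (Rbar_locally p_infty)
     (fun ab => fst ab = 1 /\ M < snd ab)).
  { intros M HM; apply (Filter_prod _ _ _ (fun a => a = 1) (fun b => M < b)).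
    - reflexivity.
    - exists M; auto.
    - intros a b Ha Hb; simpl; auto. }
  apply (RInt_gen_approx (zeta_fun s) (at_point 1) (Rbar_locally p_infty)).
  - generalize (Q 1 (Rle_refl 1)); apply filter_imp; intros [a b] [Ea Hb]; simpl in *; subst a.
    apply ex_RInt_zeta; auto; lra.
  - intros eps.
    destruct (exp_mult_ln_cv (Re s) Hr (eps * Re s)) as (M & HM & HE).
    { apply Rmult_lt_0_compat; [apply cond_pos | exact Hr]. }
    exists (RIntC (zeta_fun s) 1 M).
    generalize (Q M HM); apply filter_imp; intros [a b] [Ea Hb]; simpl in *; subst a.
    eapply Rle_lt_trans; [apply zeta_tail; auto; lra |].
    apply Rlt_div_l; assumption.
  - generalize (Q A HA); apply filter_imp; intros [a b] [Ea Hb]; simpl in *; subst a.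
    apply zeta_tail; auto; lra.
Qed.

Lemma zetaN_zeta (j : nat) (s : C) : 0 < Re s -> s <> 1%C ->
  Cmod (zetaN j s - zeta s)%C <= Cmod s * (exp (- Re s * ln (INR (S j))) / Re s).
Proof.
  intros Hr H1.
  assert (H0 : s <> 0%C) by (intro E; rewrite E in Hr; simpl in Hr; lra).
  rewrite zetaN_RInt by assumption; unfold zeta; fold (zeta_fun s).
  set (G := RInt_gen _ _ _).
  replace (_ - _)%C with (s * (G - RIntC (zeta_fun s) 1 (INR (S j))))%C by ring.
  rewrite Cmod_mult; apply Rmult_le_compat_l; [apply Cmod_ge_0 |].
  apply zeta_fun_RInt_gen; auto; rewrite S_INR; pose proof (pos_INR j); lra.
Qed.

(** Uniform in [j]: the tail estimate started at 1 bounds every truncated integral by 1 / Re s. *)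
Lemma zetaN_bound (j : nat) (s : C) : 0 < Re s -> s <> 1%C ->
  Cmod (zetaN j s) <= Cmod s * (/ Cmod (s - 1)%C + / Re s).
Proof.
  intros Hr H1.
  assert (H0 : s <> 0%C) by (intro E; rewrite E in Hr; simpl in Hr; lra).
  assert (H1' : (s - 1)%C <> 0%C) by (intro E; apply H1; transitivity ((s - 1) + 1)%C; [ring | rewrite E; ring]).
  rewrite zetaN_RInt by assumption.
  replace (_ - _)%C with (s * (/ (s - 1) - RIntC (zeta_fun s) 1 (INR (S j))))%C by (field; exact H1').
  rewrite Cmod_mult; apply Rmult_le_compat_l; [apply Cmod_ge_0 |].
  unfold Cminus at 1; eapply Rle_trans; [apply Cmod_triangle |].
  rewrite Cmod_opp, Cmod_inv by exact H1'; apply Rplus_le_compat_l.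
  assert (T := zeta_tail s 1 (INR (S j)) Hr H1 ltac:(rewrite S_INR; pose proof (pos_INR j); lra)).
  rewrite RIntC_point, ln_1, Rmult_0_r, exp_0 in T.
  unfold Rdiv in T; rewrite Rmult_1_l in T.
  rewrite Cminus_0_r in T; exact T.
Qed.

Lemma hol_rpowC D (f : C -> C) x : hol D f -> hol D (fun z => rpowC x (f z)).
Proof. intros H; apply hol_exp, hol_mult; [exact H | apply hol_const]. Qed.

Lemma hol_zetaN D (f : C -> C) j : (forall z, D z -> f z <> 0%C) -> (forall z, D z -> f z <> 1%C) ->
  hol D f -> hol D (fun z => zetaN j (f z)).
Proof.
  intros H0 H1 Hf.
  assert (H1a : forall z, D z -> (f z - 1)%C <> 0%C).
  { intros z Hz E; apply (H1 z Hz); transitivity ((f z - 1) + 1)%C; [ring | rewrite E; ring]. }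
  assert (H1b : forall z, D z -> (1 - f z)%C <> 0%C).
  { intros z Hz E; apply (H1 z Hz); transitivity (1 - (1 - f z))%C; [ring | rewrite E; ring]. }
  assert (P : forall k x, hol D (fun z => zeta_prim k (f z) x)).
  { intros k x; unfold zeta_prim; apply hol_plus.
    - apply hol_div; [exact H1b | apply hol_rpowC |]; apply hol_minus; auto using hol_const.
    - apply hol_mult; [apply hol_div; auto using hol_const | apply hol_rpowC, hol_opp, Hf]. }
  induction j as [|j IH]; cbn [zetaN].
  - apply hol_div; [exact H1a | exact Hf | apply hol_minus; auto using hol_const].
  - apply hol_minus; [exact IH |]; apply hol_mult; [exact Hf | apply hol_minus; apply P].
Qed.

(** * Gauss partial sums of log Gamma *)

(** Increments of size K (1/n - 1/(n+1)) add up to at most K/n, which gives both convergence and its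
    rate. *)
Lemma telescoping_cv (v : nat -> R) (K : R) (N0 : nat) : 0 <= K -> (1 <= N0)%nat ->
  (forall n, (N0 <= n)%nat -> Rabs (v (S n) - v n) <= K * (/ INR n - / INR (S n))) ->
  exists l : R, is_lim_seq v l /\ forall n, (N0 <= n)%nat -> Rabs (v n - l) <= K / INR n.
Proof.
  intros HK HN0 Hv.
  assert (Hpos : forall n, (N0 <= n)%nat -> 0 < INR n) by (intros; apply lt_0_INR; lia).
  assert (T : forall n m, (N0 <= n)%nat -> Rabs (v (n + m)%nat - v n) <= K * (/ INR n - / INR (n + m))).
  { intros n m Hn; induction m as [|m IH].
    - rewrite Nat.add_0_r, !Rminus_diag, Rabs_R0; lra.
    - rewrite Nat.add_succ_r.
      replace (v (S (n + m)) - v n) with ((v (S (n + m)) - v (n + m)%nat) + (v (n + m)%nat - v n)) by ring.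
      eapply Rle_trans; [apply Rabs_triang |].
      pose proof (Hv (n + m)%nat ltac:(lia)); lra. }
  assert (T' : forall n m, (N0 <= n)%nat -> Rabs (v (n + m)%nat - v n) <= K / INR n).
  { intros n m Hn; eapply Rle_trans; [apply T, Hn |]; unfold Rdiv; apply Rmult_le_compat_l; [exact HK |].
    pose proof (Rinv_0_lt_compat _ (Hpos (n + m)%nat ltac:(lia))); lra. }
  assert (C : ex_finite_lim_seq v).
  { apply ex_lim_seq_cauchy_corr; intros eps.
    destruct (INR_unbounded (2 * K / eps)) as [j Hj].
    assert (Heps := cond_pos eps).
    exists (N0 + j)%nat; intros p q Hp Hq.
    assert (Hb : K / INR (N0 + j) < eps / 2).
    { apply Rlt_div_l; [apply Hpos; lia |].
      apply Rlt_div_l in Hj; [| exact Heps].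
      assert (INR j <= INR (N0 + j)) by (apply le_INR; lia).
      nra. }
    assert (A1 := T' (N0 + j)%nat (p - (N0 + j))%nat ltac:(lia)).
    assert (A2 := T' (N0 + j)%nat (q - (N0 + j))%nat ltac:(lia)).
    replace (N0 + j + (p - (N0 + j)))%nat with p in A1 by lia.
    replace (N0 + j + (q - (N0 + j)))%nat with q in A2 by lia.
    replace (v p - v q) with ((v p - v (N0 + j)%nat) - (v q - v (N0 + j)%nat)) by ring.
    eapply Rle_lt_trans; [apply Rabs_triang |]; rewrite Rabs_Ropp; lra. }
  destruct C as [l Hl]; exists l; split; [exact Hl |]; intros n Hn.
  assert (L : is_lim_seq (fun m => Rabs (v (m + n)%nat - v n)) (Rabs (l - v n))).
  { apply (is_lim_seq_abs _ (Finite (l - v n))).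
    apply is_lim_seq_minus'; [apply is_lim_seq_incr_n; exact Hl | apply is_lim_seq_const]. }
  rewrite Rabs_minus_sym.
  refine (is_lim_seq_le _ _ _ (Finite _) _ L (is_lim_seq_const (K / INR n))).
  intros m; rewrite Nat.add_comm; apply T', Hn.
Qed.

Definition lgN (n : nat) (z : C) : C :=
  (RtoC (ln (INR (fact n))) + z * RtoC (ln (INR n))
     - sum_n (fun k => clog (z + RtoC (INR k))) n)%C.

Lemma Re_lgN n z : Re (lgN n z) =
  ln (INR (fact n)) + Re z * ln (INR n) - sum_n (fun k => ln (Cmod (z + RtoC (INR k))%C)) n.
Proof.
  unfold lgN.
  assert (E : Re (sum_n (fun k => clog (z + RtoC (INR k))%C) n) =
              sum_n (fun k => ln (Cmod (z + RtoC (INR k))%C)) n).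
  { induction n as [|n IH]; [rewrite !sum_O; reflexivity |].
    rewrite !sum_Sn, <- IH; reflexivity. }
  rewrite <- E; unfold Re; simpl; ring.
Qed.

Lemma Im_lgN n z : Im (lgN n z) =
  Im z * ln (INR n) - sum_n (fun k => carg (z + RtoC (INR k))%C) n.
Proof.
  unfold lgN.
  assert (E : Im (sum_n (fun k => clog (z + RtoC (INR k))%C) n) =
              sum_n (fun k => carg (z + RtoC (INR k))%C) n).
  { induction n as [|n IH]; [rewrite !sum_O; reflexivity |].
    rewrite !sum_Sn, <- IH; reflexivity. }
  rewrite <- E; unfold Im; simpl; ring.
Qed.

Lemma ln_le_sub1 x : 0 < x -> ln x <= x - 1.
Proof.
  intros Hx; pose proof (exp_ineq1_le (ln x)) as H; rewrite exp_ln in H by exact Hx; lra.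
Qed.

Lemma ln_ge_1_inv x : 0 < x -> 1 - / x <= ln x.
Proof.
  intros Hx; pose proof (ln_le_sub1 (/ x) (Rinv_0_lt_compat _ Hx)) as H.
  rewrite ln_Rinv in H by exact Hx; lra.
Qed.

Lemma ln_succ_bound n : 0 < n -> Rabs (ln (n + 1) - ln n - / (n + 1)) <= / n - / (n + 1).
Proof.
  intros Hn; rewrite <- ln_div by lra.
  assert (Hq : 0 < (n + 1) / n) by (apply Rdiv_lt_0_compat; lra).
  pose proof (ln_le_sub1 _ Hq) as A; pose proof (ln_ge_1_inv _ Hq) as B.
  replace ((n + 1) / n - 1) with (/ n) in A by (field; lra).
  replace (1 - / ((n + 1) / n)) with (/ (n + 1)) in B by (field; lra).
  rewrite Rabs_pos_eq; lra.
Qed.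

Lemma inv_succ_diff n : 0 < n -> / n - / (n + 1) = / (n * (n + 1)).
Proof. intros; field; lra. Qed.

(** For r >= 0 the mean value theorem gives atan r = r / (1 + c^2) with 0 <= c <= r, and 1 - c <= 1
    / (1 + c^2) <= 1. Oddness covers negative r. *)
Lemma atan_bound r : Rabs (atan r - r) <= r ^ 2.
Proof.
  assert (P : forall r, 0 <= r -> Rabs (atan r - r) <= r ^ 2).
  { intros x Hx.
    destruct (MVT_gen atan 0 x (fun c => / (1 + c ^ 2))) as (c & Hc & E).
    - intros y _; eapply is_derive_val; [auto_derive; [auto | reflexivity] |].
      field; nra.
    - intros y _; apply derivable_continuous_pt, derivable_pt_atan.
    - rewrite Rmin_left, Rmax_right in Hc by lra; rewrite atan_0, !Rminus_0_r in E.
      rewrite E.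
      assert (Hi : / (1 + c ^ 2) * (1 + c ^ 2) = 1) by (field; nra).
      assert (0 < / (1 + c ^ 2)) by (apply Rinv_0_lt_compat; nra).
      set (i := / (1 + c ^ 2)) in *.
      assert (i <= 1) by nra.
      assert (1 - c <= i) by nra.
      rewrite Rabs_minus_sym, Rabs_pos_eq by nra; nra. }
  destruct (Rle_dec 0 r); [apply P; assumption |].
  rewrite <- (Ropp_involutive r), atan_opp.
  replace (- atan (- r) - - - r) with (- (atan (- r) - - r)) by ring.
  rewrite Rabs_Ropp; replace ((- - r) ^ 2) with ((- r) ^ 2) by ring; apply P; lra.
Qed.

(** q - ln (1 + q) lies between 0 and q^2 / (1 + q), and 1 + q >= 1/4 gives the 4. *)
Lemma ln_1_plus_bound q : -3/4 <= q -> Rabs (ln (1 + q) - q) <= 4 * q ^ 2.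
Proof.
  intros Hq.
  pose proof (ln_le_sub1 (1 + q) ltac:(lra)); pose proof (ln_ge_1_inv (1 + q) ltac:(lra)).
  assert (Hi : / (1 + q) * (1 + q) = 1) by (field; lra).
  assert (0 < / (1 + q)) by (apply Rinv_0_lt_compat; lra).
  set (i := / (1 + q)) in *.
  assert (i <= 4) by nra.
  assert (q - (1 - i) = i * q ^ 2) by nra.
  rewrite Rabs_minus_sym, Rabs_pos_eq by lra; nra.
Qed.

(** The squared modulus is M^2 (1 + q), where 2x/M is the linear part of q. From 2B <= M follow q >=
    -3/4 and |q| <= 3B/M, so the error is at most (18 + 1) B^2 / M^2. The constant 20 is shared with
    the bound for the argument. *)
Lemma ln_Cmod_bound (x y B M : R) : 0 < B -> Rabs x <= B -> Rabs y <= B -> 2 * B <= M ->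
  Rabs (ln (Cmod (x + M, y)) - ln M - x / M) <= 20 * B ^ 2 / (M * M).
Proof.
  intros HB Hx Hy HM.
  apply Rabs_le_between in Hx; apply Rabs_le_between in Hy.
  set (q := 2 * (x / M) + (x ^ 2 + y ^ 2) / (M * M)).
  assert (HMM : 0 < M * M) by nra.
  assert (Hq1 : (M * M) * (1 + q) = (x + M) ^ 2 + y ^ 2) by (unfold q; field; lra).
  assert (Hq : -3/4 <= q).
  { apply (Rmult_le_reg_l (M * M)); [exact HMM |].
    assert ((x + M) ^ 2 + y ^ 2 >= M * M / 4) by nra; lra. }
  assert (E : ln (Cmod (x + M, y)) = ln M + / 2 * ln (1 + q)).
  { unfold Cmod; simpl fst; simpl snd; rewrite <- Hq1.
    rewrite sqrt_mult, sqrt_square by lra.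
    rewrite ln_mult; [| lra | apply sqrt_lt_R0; lra].
    f_equal; rewrite <- (sqrt_sqrt (1 + q)) at 2 by lra.
    rewrite ln_mult by (apply sqrt_lt_R0; lra); lra. }
  rewrite E.
  replace (ln M + / 2 * ln (1 + q) - ln M - x / M)
    with (/ 2 * (ln (1 + q) - q) + / 2 * ((x ^ 2 + y ^ 2) / (M * M))) by (unfold q; field; lra).
  assert (Hq2 : q ^ 2 <= 9 * B ^ 2 / (M * M)).
  { apply (Rmult_le_reg_r (M * M)); [exact HMM |].
    replace (9 * B ^ 2 / (M * M) * (M * M)) with ((3 * B) ^ 2) by (field; lra).
    replace (q ^ 2 * (M * M)) with ((q * M) ^ 2) by ring.
    assert (q * M = 2 * x + (x ^ 2 + y ^ 2) / M) by (unfold q; field; lra).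
    assert (0 <= (x ^ 2 + y ^ 2) / M <= B).
    { split; [apply Rdiv_le_0_compat; nra |]. apply Rle_div_l; nra. }
    rewrite H; apply pow_maj_Rabs; apply Rabs_le; lra. }
  assert (H2 : 0 <= (x ^ 2 + y ^ 2) / (M * M) <= 2 * B ^ 2 / (M * M)).
  { split; [apply Rdiv_le_0_compat; nra |].
    unfold Rdiv; apply Rmult_le_compat_r; [left; apply Rinv_0_lt_compat, HMM | nra]. }
  eapply Rle_trans; [apply Rabs_triang |].
  rewrite !Rabs_mult, (Rabs_pos_eq (/ 2)), (Rabs_pos_eq ((x ^ 2 + y ^ 2) / (M * M))) by lra.
  pose proof (ln_1_plus_bound q Hq).
  unfold Rdiv in *; lra.
Qed.

Lemma atan_quot_bound (x y B M : R) : 0 < B -> Rabs x <= B -> Rabs y <= B -> 2 * B <= M ->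
  Rabs (atan (y / (x + M)) - y / M) <= 20 * B ^ 2 / (M * M).
Proof.
  intros HB Hx Hy HM.
  assert (Hx' := proj1 (Rabs_le_between _ _) Hx).
  assert (HMM : 0 < M * M) by nra.
  set (r := y / (x + M)).
  assert (Hr : r ^ 2 <= 4 * B ^ 2 / (M * M)).
  { replace (4 * B ^ 2 / (M * M)) with ((2 * B / M) ^ 2) by (field; lra).
    apply pow_maj_Rabs; unfold r; rewrite Rabs_div by lra.
    rewrite (Rabs_pos_eq (x + M)) by lra.
    apply Rle_div_l; [lra |].
    replace (2 * B / M * (x + M)) with (B + B / M * (2 * x + M)) by (field; lra).
    assert (0 <= B / M * (2 * x + M)) by (apply Rmult_le_pos; [apply Rdiv_le_0_compat |]; lra); lra. }
  assert (Hd : Rabs (r - y / M) <= 2 * B ^ 2 / (M * M)).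
  { replace (r - y / M) with (- (y * x) * (/ (M * (x + M)))) by (unfold r; field; lra).
    assert (HI : 0 < / (M * (x + M))) by (apply Rinv_0_lt_compat; nra).
    rewrite Rabs_mult, Rabs_Ropp, Rabs_mult, (Rabs_pos_eq (/ (M * (x + M)))) by lra.
    apply Rle_trans with (B ^ 2 * (2 / (M * M))); [| right; field; lra].
    apply Rmult_le_compat; [| lra | |].
    - apply Rmult_le_pos; apply Rabs_pos.
    - pose proof (Rabs_pos x); pose proof (Rabs_pos y); nra.
    - apply Rle_div_r; [exact HMM |].
      apply (Rmult_le_reg_l (M * (x + M))); [nra |].
      replace (M * (x + M) * (/ (M * (x + M)) * (M * M))) with (M * M) by (field; lra); nra. }
  replace (atan r - y / M) with ((atan r - r) + (r - y / M)) by ring.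
  eapply Rle_trans; [apply Rabs_triang |]; pose proof (atan_bound r).
  assert (0 <= B ^ 2 / (M * M)) by (apply Rdiv_le_0_compat; nra).
  unfold Rdiv in *; lra.
Qed.

(** With m = n, the increment is z (ln (m+1) - ln m - 1/(m+1)) minus (Log (z+m+1) - ln (m+1) -
    z/(m+1)). The first bracket is at most 1/m - 1/(m+1); the second is O(1/(m+1)^2), hence also
    O(1/m - 1/(m+1)). *)
Lemma lgN_step (B : R) (z : C) (n : nat) : 0 < B -> Rabs (Re z) <= B -> Rabs (Im z) <= B ->
  (1 <= n)%nat -> 2 * B <= INR n ->
  Rabs (Re (lgN (S n) z) - Re (lgN n z)) <= (B + 20 * B ^ 2) * (/ INR n - / INR (S n)) /\
  Rabs (Im (lgN (S n) z) - Im (lgN n z)) <= (B + 20 * B ^ 2) * (/ INR n - / INR (S n)).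
Proof.
  intros HB Hx Hy Hn HnB.
  rewrite !Re_lgN, !Im_lgN, !sum_Sn, S_INR.
  assert (Hn0 : 1 <= INR n) by (apply (le_INR 1); exact Hn).
  rewrite fact_simpl, mult_INR, ln_mult, S_INR;
    [| apply lt_0_INR; lia | apply INR_fact_lt_0].
  destruct z as [x y]; unfold Re, Im in Hx, Hy |- *; simpl in Hx, Hy |- *.
  unfold plus; simpl.
  set (m := INR n) in *.
  replace ((x, y) + RtoC (m + 1))%C with (x + (m + 1), y) by (apply C_eq; simpl; ring).
  assert (L := ln_succ_bound m ltac:(lra)).
  assert (D0 : 0 < / m - / (m + 1)) by (rewrite inv_succ_diff by lra; apply Rinv_0_lt_compat; nra).
  assert (Q : 20 * B ^ 2 / ((m + 1) * (m + 1)) <= 20 * B ^ 2 * (/ m - / (m + 1))).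
  { rewrite inv_succ_diff by lra; unfold Rdiv; apply Rmult_le_compat_l; [nra |].
    apply Rinv_le_contravar; nra. }
  assert (P : forall a, Rabs a <= B -> Rabs (a * (ln (m + 1) - ln m - / (m + 1))) <= B * (/ m - / (m + 1))).
  { intros a Ha; rewrite Rabs_mult; apply Rmult_le_compat; auto using Rabs_pos. }
  split.
  - pose proof (ln_Cmod_bound x y B (m + 1) HB Hx Hy ltac:(lra)) as A.
    match goal with |- Rabs ?e <= _ =>
      replace e with (x * (ln (m + 1) - ln m - / (m + 1)) +
        - (ln (Cmod (x + (m + 1), y)) - ln (m + 1) - x / (m + 1))) by (unfold Rdiv; ring) end.
    eapply Rle_trans; [apply Rabs_triang |]; rewrite Rabs_Ropp; pose proof (P x Hx); lra.
  - pose proof (atan_quot_bound x y B (m + 1) HB Hx Hy ltac:(lra)) as A.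
    apply Rabs_le_between in Hx.
    rewrite carg_right by (simpl; lra); simpl.
    match goal with |- Rabs ?e <= _ =>
      replace e with (y * (ln (m + 1) - ln m - / (m + 1)) +
        - (atan (y / (x + (m + 1))) - y / (m + 1))) by (unfold Rdiv; ring) end.
    eapply Rle_trans; [apply Rabs_triang |]; rewrite Rabs_Ropp; pose proof (P y Hy); lra.
Qed.

Lemma lgN_cv (B : R) (z : C) (n : nat) : 0 < B -> Rabs (Re z) <= B -> Rabs (Im z) <= B ->
  (1 <= n)%nat -> 2 * B <= INR n ->
  Cmod (lgN n z - logGamma z)%C <= 2 * (B + 20 * B ^ 2) / INR n.
Proof.
  intros HB Hx Hy Hn HnB.
  assert (HK : 0 <= B + 20 * B ^ 2) by nra.
  assert (S : forall m, (n <= m)%nat -> 2 * B <= INR m) by (intros m Hm; apply le_INR in Hm; lra).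
  destruct (telescoping_cv (fun n => Re (lgN n z)) _ n HK Hn) as (l1 & L1 & B1).
  { intros m Hm; apply lgN_step; auto; lia. }
  destruct (telescoping_cv (fun n => Im (lgN n z)) _ n HK Hn) as (l2 & L2 & B2).
  { intros m Hm; apply lgN_step; auto; lia. }
  assert (E : logGamma z = (l1, l2)).
  { change (clim (fun n => lgN n z) = (l1, l2)); unfold clim.
    rewrite (is_lim_seq_unique _ _ L1), (is_lim_seq_unique _ _ L2); reflexivity. }
  rewrite E; eapply Rle_trans; [apply Cmod_le_abs |].
  replace (2 * (B + 20 * B ^ 2) / INR n) with ((B + 20 * B ^ 2) / INR n + (B + 20 * B ^ 2) / INR n) by (unfold Rdiv; ring).
  apply Rplus_le_compat; [exact (B1 n (le_n n)) | exact (B2 n (le_n n))].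
Qed.

(** * Growth of the factors *)

Lemma exp_le (x y : R) : x <= y -> exp x <= exp y.
Proof. intros [H | ->]; [left; apply exp_increasing, H | right; reflexivity]. Qed.

(** The squared moduli Q and P satisfy Q = P + 4mh, so ln (Q/P) >= 1 - P/Q = 4mh/Q; half of this is
    the claim, after Q <= (m+1)^2 + y^2. *)
Lemma log_ratio_lower (m h y : R) : 0 < m -> 0 < h < 1 -> 0 < (m - h) ^ 2 + y ^ 2 ->
  2 * h * (m / ((m + 1) ^ 2 + y ^ 2)) <= ln (Cmod (m + h, y)) - ln (Cmod (m - h, - y)).
Proof.
  intros Hm Hh HP; unfold Cmod; simpl fst; simpl snd.
  replace ((- y) ^ 2) with (y ^ 2) by ring.
  set (P := (m - h) ^ 2 + y ^ 2) in *; set (Q := (m + h) ^ 2 + y ^ 2).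
  assert (HQ : Q = P + 4 * m * h) by (unfold P, Q; ring).
  assert (HQ0 : 0 < Q) by nra.
  assert (Hs : forall a, 0 < a -> ln (sqrt a) = / 2 * ln a).
  { intros a Ha; rewrite <- (sqrt_sqrt a) at 2 by lra.
    rewrite ln_mult by (apply sqrt_lt_R0; lra); lra. }
  rewrite !Hs, <- Rmult_minus_distr_l, <- ln_div by assumption.
  assert (Hr : 0 < Q / P) by (apply Rdiv_lt_0_compat; assumption).
  pose proof (ln_ge_1_inv _ Hr) as L.
  replace (1 - / (Q / P)) with (4 * m * h / Q) in L by (rewrite HQ in *; field; lra).
  apply Rle_trans with (2 * h * (m / Q)); [| unfold Rdiv in *; lra].
  apply Rmult_le_compat_l; [lra |]; unfold Rdiv; apply Rmult_le_compat_l; [lra |].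
  apply Rinv_le_contravar; [exact HQ0 | unfold Q; nra].
Qed.

(** Telescoping minorant for the sums of [(k + 1/4) / ((k + 5/4)^2 + y^2)]: the
    logarithm is the integral, the second term absorbs the [O(1/k^2)] error. *)
Definition log_potential (y k : R) : R := / 2 * ln ((k + 5/4) ^ 2 + y ^ 2) + 3/2 * / (k + 3/4).

(** With a = k + 5/4 and P = a^2 + y^2, the right side is half of (2a+1)/P minus (3/2)/P. The first
    term dominates the step of half the logarithm. For the second, (k + 3/4)(k + 7/4) = a^2 - 1/4 <=
    P bounds 1/P by a telescoping difference. *)
Lemma log_potential_step (y k : R) : 0 <= k ->
  log_potential y (k + 1) - log_potential y k <= (k + 1/4) / ((k + 1/4 + 1) ^ 2 + y ^ 2).
Proof.
  intros Hk; unfold log_potential.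
  replace (k + 1/4 + 1) with (k + 5/4) by lra.
  set (a := k + 5/4); replace (k + 1 + 5/4) with (a + 1) by (unfold a; lra).
  set (P := a ^ 2 + y ^ 2).
  assert (HP : a ^ 2 <= P) by (unfold P; nra).
  assert (Ha : 1 < a) by (unfold a; lra).
  assert (HP0 : 0 < P) by nra.
  assert (HQ : (a + 1) ^ 2 + y ^ 2 = P + (2 * a + 1)) by (unfold P; ring).
  rewrite HQ.
  assert (L : ln (P + (2 * a + 1)) - ln P <= (2 * a + 1) / P).
  { rewrite <- ln_div by lra.
    eapply Rle_trans; [apply ln_le_sub1, Rdiv_lt_0_compat; lra |].
    right; field; lra. }
  assert (I : / P <= / (k + 3/4) - / (k + 1 + 3/4)).
  { replace (/ (k + 3/4) - / (k + 1 + 3/4)) with (/ ((k + 3/4) * (k + 1 + 3/4))) by (field; lra).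
    apply Rinv_le_contravar; unfold a in HP; nra. }
  replace ((k + 1/4) / P) with (/ 2 * ((2 * a + 1) / P) - 3/2 * / P) by (unfold a; field; lra).
  lra.
Qed.

Lemma sum_n_Sn_R (a : nat -> R) (n : nat) : sum_n a (S n) = sum_n a n + a (S n).
Proof. exact (sum_Sn a n). Qed.

(** The left side is the difference of the real parts of the two Gauss sums, where the factorials
    cancel. The potential at n + 1 exceeds ln n and compensates 2h ln n; what remains is 2h times
    the potential at 0, with 2h < 2. The last hypothesis keeps every k + 1/4 - h - iy away from
    0. *)
Lemma log_product_bound (y h : R) (n : nat) : 0 < h < 1 -> (1 <= n)%nat -> (y <> 0 \/ h < 1/4) ->
  2 * h * ln (INR n) -
    (sum_n (fun k => ln (Cmod (1/4 + INR k + h, y))) n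
     - sum_n (fun k => ln (Cmod (1/4 + INR k - h, - y))) n)
  <= 2 * (/ 2 * ln (25/16 + y ^ 2) + 2).
Proof.
  intros Hh Hn Hy.
  assert (S : 2 * h * (log_potential y (INR n + 1) - log_potential y 0) <=
     sum_n (fun k => ln (Cmod (1/4 + INR k + h, y))) n
     - sum_n (fun k => ln (Cmod (1/4 + INR k - h, - y))) n).
  { assert (T : forall k, 2 * h * (log_potential y (INR k + 1) - log_potential y (INR k)) <=
      ln (Cmod (1/4 + INR k + h, y)) - ln (Cmod (1/4 + INR k - h, - y))).
    { intros k; pose proof (pos_INR k).
      eapply Rle_trans; [| apply log_ratio_lower; try lra].
      - apply Rmult_le_compat_l; [lra |].
        replace (1/4 + INR k) with (INR k + 1/4) by ring; apply log_potential_step, pos_INR.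
      - pose proof (pow2_ge_0 y); pose proof (pow2_ge_0 (1/4 + INR k - h)).
        destruct Hy as [Hy|Hy].
        + pose proof (pow2_gt_0 y Hy); lra.
        + pose proof (pow2_gt_0 (1/4 + INR k - h) ltac:(lra)); lra. }
    clear Hn; induction n as [|n IH].
    - rewrite !sum_O; pose proof (T 0%nat) as T0; simpl INR in *; lra.
    - rewrite !sum_n_Sn_R; pose proof (T (S n)) as T1; rewrite S_INR in T1 at 1 2.
      rewrite (S_INR n) at 1; lra. }
  assert (Hn0 : 1 <= INR n) by (apply (le_INR 1); exact Hn).
  assert (P1 : ln (INR n) <= log_potential y (INR n + 1)).
  { unfold log_potential.
    assert (0 < / (INR n + 1 + 3/4)) by (apply Rinv_0_lt_compat; lra).
    assert (ln (INR n * INR n) <= ln ((INR n + 1 + 5/4) ^ 2 + y ^ 2)) by (apply ln_le; nra).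
    rewrite ln_mult in H0 by lra; lra. }
  assert (P0 : log_potential y 0 = / 2 * ln (25/16 + y ^ 2) + 2).
  { unfold log_potential; replace ((0 + 5/4) ^ 2) with (25/16) by field; f_equal; field. }
  assert (L0 : 0 <= ln (25/16 + y ^ 2)).
  { rewrite <- ln_1; apply ln_le; nra. }
  rewrite <- P0; assert (0 <= log_potential y 0) by (rewrite P0; lra).
  nra.
Qed.

(** * The exponential of i theta and of its approximations *)

Definition thN (n : nat) (w : C) : C :=
  ((lgN n (RtoC (1/4) + Ci * w / RtoC 2) - lgN n (RtoC (1/4) - Ci * w / RtoC 2)) / (RtoC 2 * Ci)
   - w / RtoC 2 * RtoC (ln PI))%C.

Lemma Ci_neq0 : Ci <> 0%C.
Proof. intro E; apply (f_equal snd) in E; simpl in E; lra. Qed.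

Lemma C2_neq0 : RtoC 2 <> 0%C.
Proof. intro E; apply (f_equal fst) in E; simpl in E; lra. Qed.

Lemma Ci_theta_split (A B w L : C) :
  (Ci * ((A - B) / (RtoC 2 * Ci) - w / RtoC 2 * L) = (A - B) / RtoC 2 - Ci * w / RtoC 2 * L)%C.
Proof. field; repeat split; auto using C2_neq0, Ci_neq0. Qed.

Lemma Re_Ci_theta (A B w : C) (L : R) :
  Re (Ci * ((A - B) / (RtoC 2 * Ci) - w / RtoC 2 * RtoC L))%C = (Re A - Re B) / 2 + Im w / 2 * L.
Proof. rewrite Ci_theta_split; unfold Re, Im; simpl; field. Qed.

Lemma theta_arg_plus (w : C) : (RtoC (1/4) + Ci * w / RtoC 2)%C = (1/4 - Im w / 2, Re w / 2).
Proof. apply C_eq; unfold Re, Im; simpl; field. Qed.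

Lemma theta_arg_minus (w : C) : (RtoC (1/4) - Ci * w / RtoC 2)%C = (1/4 + Im w / 2, - (Re w / 2)).
Proof. apply C_eq; unfold Re, Im; simpl; field. Qed.

(** Half of [log_product_bound] bounds the exponent, since the ln pi term is nonpositive for Im w <
    0. Finally sqrt (25/16 + (Re w / 2)^2) <= 2 + |Re w|. *)
Lemma Cmod_cexp_thN (n : nat) (w : C) : (1 <= n)%nat -> -2 < Im w < 0 ->
  (Re w <> 0 \/ - (1/2) < Im w) ->
  exp (Re (Ci * thN n w)%C) <= exp 2 * (2 + Rabs (Re w)).
Proof.
  intros Hn Hw Hnz; unfold thN; rewrite Re_Ci_theta, !Re_lgN, theta_arg_plus, theta_arg_minus.
  pose (h := - Im w / 2); pose (y := Re w / 2).
  assert (P := log_product_bound y h n ltac:(unfold h; lra) Hn).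
  assert (Hc : y <> 0 \/ h < 1/4) by (unfold y, h; destruct Hnz; [left | right]; lra).
  specialize (P Hc).
  assert (E1 : sum_n (fun k => ln (Cmod (((1/4 - Im w / 2)%R, (Re w / 2)%R) + RtoC (INR k))%C)) n
     = sum_n (fun k => ln (Cmod (1/4 + INR k + h, y))) n).
  { apply sum_n_ext; intros k; f_equal; f_equal; apply C_eq; unfold h, y; simpl; field. }
  assert (E2 : sum_n (fun k => ln (Cmod (((1/4 + Im w / 2)%R, (- (Re w / 2))%R) + RtoC (INR k))%C)) n
     = sum_n (fun k => ln (Cmod (1/4 + INR k - h, - y))) n).
  { apply sum_n_ext; intros k; f_equal; f_equal; apply C_eq; unfold h, y; simpl; field. }
  rewrite E1, E2; clear E1 E2.
  change (Re (1/4 - Im w / 2, Re w / 2)) with (1/4 - Im w / 2).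
  change (Re (1/4 + Im w / 2, - (Re w / 2))) with (1/4 + Im w / 2).
  assert (LP : 0 <= ln PI) by (rewrite <- ln_1; apply ln_le; [lra | pose proof PI2_3_2; lra]).
  apply Rle_trans with (exp (2 + / 2 * ln (25/16 + y ^ 2))).
  - apply exp_le.
    replace (Im w) with (- (2 * h)) by (unfold h; field).
    assert (0 <= h * ln PI) by (apply Rmult_le_pos; unfold h; lra).
    lra.
  - rewrite exp_plus; apply Rmult_le_compat_l; [left; apply exp_pos |].
    assert (Q : 0 < 25/16 + y ^ 2) by nra.
    apply Rsqr_incr_0_var; [| pose proof (Rabs_pos (Re w)); lra].
    unfold Rsqr; rewrite <- exp_plus.
    replace (/ 2 * ln (25/16 + y ^ 2) + / 2 * ln (25/16 + y ^ 2)) with (ln (25/16 + y ^ 2)) by field.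
    rewrite exp_ln by exact Q.
    unfold y; pose proof (pow2_abs (Re w)); pose proof (Rabs_pos (Re w)); nra.
Qed.

(** For real t the two Gamma arguments are conjugate, so their Gauss terms have equal real parts.
    Hence exp(i theta(t)) has modulus one. *)
Lemma Re_Ci_RStheta (t : R) : Re (Ci * RStheta (RtoC t))%C = 0.
Proof.
  unfold RStheta; rewrite Re_Ci_theta.
  assert (E : Re (logGamma (RtoC (1/4) + Ci * RtoC t / RtoC 2)%C)
            = Re (logGamma (RtoC (1/4) - Ci * RtoC t / RtoC 2)%C)).
  { change (real (Lim_seq (fun n => Re (lgN n (RtoC (1/4) + Ci * RtoC t / RtoC 2)%C))) =
            real (Lim_seq (fun n => Re (lgN n (RtoC (1/4) - Ci * RtoC t / RtoC 2)%C)))).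
    f_equal; apply Lim_seq_ext; intros n.
    rewrite !Re_lgN, theta_arg_plus, theta_arg_minus; f_equal; [simpl; field |].
    apply sum_n_ext; intros k; f_equal; unfold Cmod; f_equal; simpl; field. }
  rewrite E; simpl; field.
Qed.

Lemma thN_cv (B : R) (w : C) (n : nat) : 1 <= B -> Rabs (Re w) <= B -> Rabs (Im w) <= B ->
  (1 <= n)%nat -> 2 * B <= INR n ->
  Cmod (Ci * RStheta w - Ci * thN n w)%C <= 2 * (B + 20 * B ^ 2) / INR n.
Proof.
  intros HB Hx Hy Hn HnB; unfold RStheta, thN; rewrite !Ci_theta_split.
  apply Rabs_le_between in Hx; apply Rabs_le_between in Hy.
  assert (C1 : Cmod (lgN n (RtoC (1/4) + Ci * w / RtoC 2) - logGamma (RtoC (1/4) + Ci * w / RtoC 2))%C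
     <= 2 * (B + 20 * B ^ 2) / INR n).
  { apply lgN_cv; auto; [lra | |]; rewrite theta_arg_plus; apply Rabs_le; simpl; lra. }
  assert (C2 : Cmod (lgN n (RtoC (1/4) - Ci * w / RtoC 2) - logGamma (RtoC (1/4) - Ci * w / RtoC 2))%C
     <= 2 * (B + 20 * B ^ 2) / INR n).
  { apply lgN_cv; auto; [lra | |]; rewrite theta_arg_minus; apply Rabs_le; simpl; lra. }
  revert C1 C2; set (a := lgN n _); set (a' := logGamma _); set (b := lgN n _); set (b' := logGamma _).
  intros C1 C2.
  match goal with |- Cmod ?e <= _ =>
    replace e with (RtoC (/ 2) * ((b - b') - (a - a')))%C by (rewrite RtoC_inv by lra; field; apply C2_neq0) end.
  rewrite Cmod_mult, Cmod_R, Rabs_pos_eq by lra.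
  assert (T := Cmod_triangle (b - b') (- (a - a'))); rewrite Cmod_opp in T.
  fold (Cminus (b - b') (a - a')) in T; lra.
Qed.

(** For d = x + iy the real and imaginary parts are at most 2|x| + |y| and 2|y|, which together give
    the 5. *)
Lemma Cmod_cexp_sub1 (d : C) : Cmod d <= 1/2 -> Cmod (cexp d - 1)%C <= 5 * Cmod d.
Proof.
  intros Hd.
  assert (Hx := re_le_Cmod d); assert (Hy := im_le_Cmod d).
  destruct d as [x y]; unfold cexp; simpl in Hx, Hy |- *.
  eapply Rle_trans; [apply Cmod_le_abs |]; simpl.
  assert (Hx2 : - (1/2) <= x <= 1/2) by (apply Rabs_le_between; lra).
  assert (E1 : 1 + x <= exp x) by apply exp_ineq1_le.
  assert (E2 : exp x * (1 - x) <= 1).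
  { pose proof (exp_ineq1_le (- x)) as F; pose proof (exp_pos x).
    assert (exp x * exp (- x) = 1) by (rewrite <- exp_plus, Rplus_opp_r, exp_0; reflexivity); nra. }
  assert (E3 : exp x <= 2) by nra.
  assert (E4 : Rabs (exp x - 1) <= 2 * Rabs x).
  { unfold Rabs; destruct (Rcase_abs (exp x - 1)), (Rcase_abs x); nra. }
  assert (S1 : Rabs (sin y) <= Rabs y).
  { unfold Rabs at 2; destruct (Rcase_abs y) as [c|c].
    - rewrite <- Rabs_Ropp, <- sin_neg; pose proof (sin_lt_x (- y) ltac:(lra)) as L.
      assert (0 <= sin (- y)) by (apply sin_ge_0; pose proof PI2_3_2; unfold Rabs in Hy; destruct (Rcase_abs y); lra).
      rewrite Rabs_pos_eq; lra.
    - destruct c as [c|c]; [| rewrite c, sin_0, Rabs_R0; lra].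
      pose proof (sin_lt_x y ltac:(lra)) as L.
      assert (0 <= sin y) by (apply sin_ge_0; pose proof PI2_3_2;
        unfold Rabs in Hy; destruct (Rcase_abs y); lra).
      rewrite Rabs_pos_eq; lra. }
  (* As 0 <= cos y <= 1, (1 - cos y)^2 <= 1 - cos^2 y = sin^2 y. *)
  assert (C1 : Rabs (cos y - 1) <= Rabs y).
  { pose proof (COS_bound y); pose proof (sin2_cos2 y) as SC; unfold Rsqr in SC.
    assert (Rabs (sin y) * Rabs (sin y) = sin y * sin y) by (rewrite <- Rabs_mult; apply Rabs_pos_eq; nra).
    assert (0 <= cos y) by (apply cos_ge_0; pose proof PI2_3_2; apply Rabs_le_between in Hy; lra).
    pose proof (Rabs_pos (sin y)); rewrite Rabs_minus_sym, Rabs_pos_eq by lra.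
    assert (1 - cos y <= Rabs (sin y)) by nra; lra. }
  assert (R1 : Rabs (exp x * cos y - 1) <= 2 * Rabs x + Rabs y).
  { replace (exp x * cos y - 1) with ((exp x - 1) * cos y + (cos y - 1)) by ring.
    eapply Rle_trans; [apply Rabs_triang |]; rewrite Rabs_mult.
    assert (Rabs (cos y) <= 1) by (apply Rabs_le, COS_bound).
    pose proof (Rabs_pos (exp x - 1)); pose proof (Rabs_pos (cos y)); nra. }
  assert (R2 : Rabs (exp x * sin y) <= 2 * Rabs y).
  { rewrite Rabs_mult, (Rabs_pos_eq (exp x)) by (left; apply exp_pos).
    pose proof (Rabs_pos (sin y)); pose proof (exp_pos x); nra. }
  replace (exp x * cos y + -1) with (exp x * cos y - 1) by ring.
  replace (exp x * sin y + -0) with (exp x * sin y) by ring.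
  unfold Rminus in *; lra.
Qed.

(** * Lower bounds for the hyperbolic sine *)

Lemma csinh_line (s u : R) :
  csinh (RtoC PI * hline s u / RtoC 2)%C =
  ((exp (PI * u / 2) - exp (- (PI * u / 2))) / 2 * cos (PI * s / 2),
   - ((exp (PI * u / 2) + exp (- (PI * u / 2))) / 2 * sin (PI * s / 2))).
Proof.
  rewrite hline_eq; unfold csinh.
  replace (RtoC PI * (u, (- s)%R) / RtoC 2)%C with (PI * u / 2, - (PI * s / 2)) by (apply C_eq; simpl; field).
  apply C_eq; unfold cexp; simpl; rewrite ?Ropp_involutive, ?cos_neg, ?sin_neg; field.
Qed.

(** The imaginary part has absolute value cosh (pi u / 2) sin (pi s / 2). The sine is positive
    exactly because the strip stays between the poles of the kernel at depths 0 and 2. *)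
Lemma csinh_lower_sin (s u : R) : 0 < s < 2 ->
  0 < sin (PI * s / 2) <= Cmod (csinh (RtoC PI * hline s u / RtoC 2)%C).
Proof.
  intros Hs; assert (HP := PI_RGT_0).
  assert (S0 : 0 < sin (PI * s / 2)) by (apply sin_gt_0; nra).
  split; [exact S0 |].
  eapply Rle_trans; [| apply im_le_Cmod]; rewrite csinh_line; simpl.
  rewrite Rabs_Ropp.
  assert (E := exp_ineq1_le (PI * u / 2)); assert (E' := exp_ineq1_le (- (PI * u / 2))).
  rewrite Rabs_pos_eq; nra.
Qed.

(** From |sinh (X + iY)|^2 = sinh^2 X + sin^2 Y, the bound |sinh X| holds at every depth; pi/2 > 3/2
    leaves room for exp |u| / 4. *)
Lemma csinh_lower_exp (s u : R) : 1 <= Rabs u ->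
  exp (Rabs u) / 4 <= Cmod (csinh (RtoC PI * hline s u / RtoC 2)%C).
Proof.
  intros Hu; rewrite csinh_line.
  set (X := PI * u / 2).
  set (S := (exp X - exp (- X)) / 2); set (Q := (exp X + exp (- X)) / 2).
  assert (HS : exp (Rabs u) / 4 <= Rabs S).
  { assert (P : forall v, 1 <= v -> exp v / 4 <= (exp (PI * v / 2) - exp (- (PI * v / 2))) / 2).
    { intros v Hv; assert (HP := PI2_3_2).
      assert (exp (v + v / 2) <= exp (PI * v / 2)) by (apply exp_le; nra).
      rewrite exp_plus in H.
      assert (exp (- (PI * v / 2)) <= 1) by (rewrite <- exp_0; apply exp_le; nra).
      pose proof (exp_ineq1_le (v / 2)); pose proof (exp_ineq1_le v); nra. }
    unfold Rabs at 1; unfold Rabs in Hu; destruct (Rcase_abs u).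
    - specialize (P (- u) Hu); replace (PI * - u / 2) with (- X) in P by (unfold X; field).
      rewrite Ropp_involutive in P; rewrite <- Rabs_Ropp.
      eapply Rle_trans; [| apply Rle_abs]; unfold S; lra.
    - eapply Rle_trans; [| apply Rle_abs]; exact (P u Hu). }
  eapply Rle_trans; [exact HS |].
  unfold Cmod; simpl fst; simpl snd.
  rewrite <- sqrt_Rsqr_abs; apply sqrt_le_1_alt; unfold Rsqr.
  assert (Hsc := sin2_cos2 (PI * s / 2)); unfold Rsqr in Hsc.
  assert (HQ : Q * Q = S * S + 1).
  { assert (exp X * exp (- X) = 1) by (rewrite <- exp_plus, Rplus_opp_r, exp_0; reflexivity).
    unfold Q, S; nra. }
  replace (_ + _) with (S * S * (sin (PI * s / 2) * sin (PI * s / 2) + cos (PI * s / 2) * cos (PI * s / 2)) + sin (PI * s / 2) * sin (PI * s / 2)).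
  - rewrite Hsc; nra.
  - transitivity (S * S * (cos (PI * s / 2) * cos (PI * s / 2)) + Q * Q * (sin (PI * s / 2) * sin (PI * s / 2))); [rewrite HQ |]; ring.
Qed.

(** * The truncated integrand *)

(** theta(t) stays exact: its factor is constant in [x] and of modulus one. *)
Definition UN (n : nat) (t : R) (x : C) : C :=
  (cexp (Ci * thN n (RtoC t + x) - Ci * RStheta (RtoC t))
   * zetaN n (RtoC (1/2) + Ci * (RtoC t + x))
   * (RtoC PI / (RtoC 2 * csinh (RtoC PI * x / RtoC 2))))%C.

(** Where the arguments of the logarithms stay off the cut and [s <> 1]: either
    [t + Re x > 0], or the line is still to the left of the pole of zeta. *)
Definition Udom (t : R) (x : C) : Prop :=
  -2 < Im x < 0 /\ (0 < t + Re x \/ - (1/2) < Im x).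

Lemma hol_lgN D (f : C -> C) n : (forall z k, D z -> slit (f z + RtoC (INR k))%C) ->
  hol D f -> hol D (fun z => lgN n (f z)).
Proof.
  intros Hs Hf; unfold lgN; apply hol_minus.
  - apply hol_plus; [apply hol_const | apply hol_mult; [exact Hf | apply hol_const]].
  - apply (hol_sum_n D (fun k z => clog (f z + RtoC (INR k))%C)); intros k _.
    apply hol_log; [intros z Hz; apply Hs, Hz |].
    apply hol_plus; [exact Hf | apply hol_const].
Qed.

(** The argument has real part 1/2 - Im x > 1/2, and equals 1 only if Im x = -1/2 and t + Re x = 0,
    which [Udom] excludes. *)
Lemma zeta_arg_neq (t : R) (x : C) : Udom t x ->
  (RtoC (1/2) + Ci * (RtoC t + x))%C <> 0%C /\ (RtoC (1/2) + Ci * (RtoC t + x))%C <> 1%C.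
Proof.
  destruct x as [u v]; intros [H1 H2]; simpl in H1, H2.
  split; intro E; [apply (f_equal fst) in E | assert (F := f_equal snd E); apply (f_equal fst) in E];
    simpl in E; try simpl in F; lra.
Qed.

Lemma hline_self (x : C) : x = hline (- Im x) (Re x).
Proof. rewrite hline_eq, Ropp_involutive; destruct x; reflexivity. Qed.

Lemma hol_csinh D (f : C -> C) : hol D f -> hol D (fun z => csinh (f z)).
Proof.
  intros H; unfold csinh; apply hol_mult; [| apply hol_const].
  apply hol_minus; apply hol_exp; [exact H | apply hol_opp, H].
Qed.

Lemma csinh_neq0 (s u : R) : 0 < s < 2 -> csinh (RtoC PI * hline s u / RtoC 2)%C <> 0%C.
Proof.
  intros Hs; apply Cmod_gt_0; destruct (csinh_lower_sin s u Hs); lra.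
Qed.

Lemma hol_UN (n : nat) (t : R) : hol (Udom t) (UN n t).
Proof.
  assert (Hw : hol (Udom t) (fun x => RtoC t + x)%C) by (apply hol_plus; [apply hol_const | apply hol_id]).
  assert (Hi : hol (Udom t) (fun x => Ci * (RtoC t + x) / RtoC 2)%C).
  { apply hol_mult; [apply hol_mult; [apply hol_const | exact Hw] | apply hol_const]. }
  unfold UN; apply hol_mult; [apply hol_mult |].
  - apply hol_exp, hol_minus; [| apply hol_const].
    apply hol_mult; [apply hol_const |]; unfold thN; apply hol_minus.
    + apply hol_mult; [apply hol_minus; apply hol_lgN | apply hol_const].
      * intros [u v] k [H1 H2]; simpl in H1, H2; pose proof (pos_INR k).
        rewrite theta_arg_plus; left; simpl; lra.
      * apply hol_plus; [apply hol_const | exact Hi].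
      (* The delicate argument 1/4 - iw/2: it lies in the lower half-plane when t + Re x > 0, and in
         the right half-plane when Im x > -1/2. *)
      * intros [u v] k [H1 H2]; simpl in H1, H2; pose proof (pos_INR k).
        rewrite theta_arg_minus; unfold slit; simpl; destruct H2; [right | left]; lra.
      * apply hol_minus; [apply hol_const | exact Hi].
    + apply hol_mult; [apply hol_mult; [exact Hw | apply hol_const] | apply hol_const].
  - apply hol_zetaN; [intros x Hx; apply zeta_arg_neq, Hx .. |].
    apply hol_plus; [apply hol_const | apply hol_mult; [apply hol_const | exact Hw]].
  - apply hol_div; [| apply hol_const | apply hol_mult; [apply hol_const |]].
    + intros x [Hx _]; apply Cmult_neq_0; [apply C2_neq0 |].
      rewrite (hline_self x); apply csinh_neq0; lra.
    + apply hol_csinh, hol_mult; [apply hol_mult; [apply hol_const | apply hol_id] | apply hol_const].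
Qed.

Definition zarg (t s u : R) : C := (RtoC (1/2) + Ci * (RtoC t + hline s u))%C.

Lemma zarg_eq t s u : zarg t s u = (1/2 + s, t + u).
Proof. unfold zarg; rewrite hline_eq; apply C_eq; simpl; ring. Qed.

Lemma RtoC_hline t s u : (RtoC t + hline s u)%C = (t + u, - s).
Proof. rewrite hline_eq; apply C_eq; simpl; ring. Qed.

Lemma hline_Udom t s u : 0 < s < 2 -> 0 < t + u \/ s < 1/2 -> Udom t (hline s u).
Proof. intros Hs Hu; rewrite hline_eq; split; simpl; lra. Qed.

(** On the line of depth s the zeta argument has real part 1/2 + s, between 1/2 and 5/2: this gives
    the summand 2 (a bound for 1 / Re) and the 3. The last bound uses pi <= 4. *)
Lemma UN_factor_bounds (n : nat) (t s u del eta : R) : (1 <= n)%nat -> 0 < s < 2 ->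
  0 < t + u \/ s < 1/2 -> 0 < del -> del <= Cmod (zarg t s u - 1)%C ->
  0 < eta -> eta <= Cmod (csinh (RtoC PI * hline s u / RtoC 2)%C) ->
  Cmod (cexp (Ci * thN n (RtoC t + hline s u) - Ci * RStheta (RtoC t))%C) <= exp 2 * (2 + Rabs (t + u)) /\
  Cmod (zetaN n (zarg t s u)) <= (3 + Rabs (t + u)) * (/ del + 2) /\
  Cmod (RtoC PI / (RtoC 2 * csinh (RtoC PI * hline s u / RtoC 2)))%C <= 2 / eta.
Proof.
  intros Hn Hs Hd Hdel Hz Heta Hsh; split; [| split].
  - rewrite Cmod_cexp.
    replace (Re (Ci * thN n (RtoC t + hline s u) - Ci * RStheta (RtoC t))%C)
      with (Re (Ci * thN n (RtoC t + hline s u))%C - Re (Ci * RStheta (RtoC t))%C) by (simpl; ring).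
    rewrite Re_Ci_RStheta, Rminus_0_r, RtoC_hline.
    apply Cmod_cexp_thN; auto; simpl; lra.
  - destruct (zeta_arg_neq t (hline s u) (hline_Udom t s u Hs Hd)) as [N0 N1].
    fold (zarg t s u) in N0, N1.
    assert (HR : Re (zarg t s u) = 1/2 + s) by (rewrite zarg_eq; reflexivity).
    eapply Rle_trans; [apply zetaN_bound; [rewrite HR; lra | exact N1] |].
    rewrite HR; apply Rmult_le_compat.
    + apply Cmod_ge_0.
    + apply Rplus_le_le_0_compat; left; apply Rinv_0_lt_compat; lra.
    + eapply Rle_trans; [apply Cmod_le_abs |]; rewrite zarg_eq; simpl.
      rewrite (Rabs_pos_eq (1/2 + s)) by lra; lra.
    + apply Rplus_le_compat; [apply Rinv_le_contravar; assumption |].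
      replace 2 with (/ (1/2)) by field; apply Rinv_le_contravar; lra.
  - rewrite Cmod_div, Cmod_mult, !Cmod_R, !Rabs_pos_eq; try lra; try (left; apply PI_RGT_0).
    2:{ apply Cmult_neq_0; [apply C2_neq0 | apply csinh_neq0, Hs]. }
    assert (HP := PI_4); assert (HP0 := PI_RGT_0).
    set (c := Cmod (csinh _)) in *.
    replace (PI / (2 * c)) with (PI / 2 * / c) by (field; lra).
    unfold Rdiv at 2; apply Rmult_le_compat; [lra | left; apply Rinv_0_lt_compat; lra | lra |].
    apply Rinv_le_contravar; assumption.
Qed.

(** With v = |t + u|, the factors are at most exp 2 (2 + v), 6 (3 + v) and 8 exp(-|u|). Since 3 + v
    <= 4 t exp(|u|/4), the product costs 48 * 16 = 768 and half of the exponential. *)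
Lemma UN_decay (n : nat) (t s u : R) : (1 <= n)%nat -> 3 <= t -> 1 <= Rabs u -> 0 < s < 2 ->
  0 < t + u \/ s < 1/2 -> 1/4 <= Cmod (zarg t s u - 1)%C ->
  Cmod (UN n t (hline s u)) <= 768 * exp 2 * t ^ 2 * exp (- (Rabs u / 2)).
Proof.
  intros Hn Ht Hu Hs Hd Hz.
  assert (He : 0 < exp (Rabs u) / 4) by (pose proof (exp_pos (Rabs u)); lra).
  destruct (UN_factor_bounds n t s u (1/4) (exp (Rabs u) / 4) Hn Hs Hd ltac:(lra) Hz He
     (csinh_lower_exp s u Hu)) as (B1 & B2 & B3).
  unfold UN; fold (zarg t s u); rewrite !Cmod_mult.
  set (a := Cmod (cexp _)) in *; set (z := Cmod (zetaN _ _)) in *; set (c := Cmod (_ / _)%C) in *.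
  assert (Ha : 0 <= a) by apply Cmod_ge_0; assert (Hzz : 0 <= z) by apply Cmod_ge_0;
    assert (Hc : 0 <= c) by apply Cmod_ge_0.
  replace (/ (1/4) + 2) with 6 in B2 by field.
  replace (2 / (exp (Rabs u) / 4)) with (8 * exp (- Rabs u)) in B3
    by (rewrite exp_Ropp; field; pose proof (exp_pos (Rabs u)); lra).
  assert (V : 3 + Rabs (t + u) <= 4 * t * exp (Rabs u / 4)).
  { assert (Rabs (t + u) <= t + Rabs u)
      by (eapply Rle_trans; [apply Rabs_triang |]; rewrite (Rabs_pos_eq t) by lra; lra).
    pose proof (exp_ineq1_le (Rabs u / 4)); nra. }
  pose proof (Rabs_pos (t + u)) as V0.
  set (v := Rabs (t + u)) in *; set (q := exp (Rabs u / 4)) in *.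
  assert (Hq : 0 < q) by apply exp_pos; pose proof (exp_pos 2) as H2.
  assert (Eq : exp (- (Rabs u / 2)) = q * q * exp (- Rabs u)).
  { unfold q; rewrite <- !exp_plus; f_equal; field. }
  rewrite Eq; pose proof (exp_pos (- Rabs u)) as Hr; set (r := exp (- Rabs u)) in *.
  apply Rle_trans with (exp 2 * (2 + v) * ((3 + v) * 6) * (8 * r)).
  - apply Rmult_le_compat; try assumption; [apply Rmult_le_pos; assumption |].
    apply Rmult_le_compat; assumption.
  - apply Rle_trans with (exp 2 * 48 * r * ((4 * t * q) * (4 * t * q))); [| right; ring].
    replace (exp 2 * (2 + v) * ((3 + v) * 6) * (8 * r)) with (exp 2 * 48 * r * ((2 + v) * (3 + v))) by ring.
    apply Rmult_le_compat_l; [apply Rmult_le_pos; lra |].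
    apply Rmult_le_compat; lra.
Qed.

(** The exact exponential factor is [En * cexp d]. As |cexp d - 1| is at most 5|d| <= 3, the zeta
    error enters 1 + 3 times and the theta error as 5 aZ |d|. *)
Lemma UN_error (En Zn Z S d : C) (aE aZ aS eZ : R) : Cmod d <= 1/2 ->
  Cmod En <= aE -> Cmod Zn <= aZ -> Cmod S <= aS -> Cmod (Zn - Z)%C <= eZ ->
  Cmod (En * Zn * S - (En * cexp d) * Z * S)%C <= aE * aS * (4 * eZ + 5 * aZ * Cmod d).
Proof.
  intros Hd HE HZ HS He.
  assert (Hx := Cmod_cexp_sub1 d Hd).
  replace (En * Zn * S - (En * cexp d) * Z * S)%C
    with (En * S * ((Zn - Z) + ((cexp d - 1) * (Zn - Z) + - ((cexp d - 1) * Zn))))%C by ring.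
  rewrite !Cmod_mult.
  assert (0 <= Cmod En) by apply Cmod_ge_0. assert (0 <= Cmod S) by apply Cmod_ge_0.
  assert (0 <= Cmod d) by apply Cmod_ge_0. assert (0 <= Cmod Zn) by apply Cmod_ge_0.
  assert (0 <= Cmod (cexp d - 1)%C) by apply Cmod_ge_0. assert (0 <= Cmod (Zn - Z)%C) by apply Cmod_ge_0.
  apply Rmult_le_compat; [apply Rmult_le_pos; assumption | apply Cmod_ge_0 | apply Rmult_le_compat; assumption |].
  eapply Rle_trans; [apply Cmod_triangle |].
  eapply Rle_trans; [apply Rplus_le_compat_l, Cmod_triangle |].
  rewrite Cmod_opp, !Cmod_mult.
  assert (Cmod (cexp d - 1)%C * Cmod (Zn - Z)%C <= 3 * eZ) by (apply Rmult_le_compat; lra).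
  assert (Cmod (cexp d - 1)%C * Cmod Zn <= 5 * Cmod d * aZ) by (apply Rmult_le_compat; lra).
  lra.
Qed.

Lemma UN_uniform (t s b del : R) : 0 < s < 2 -> 0 < del ->
  (forall u, Rabs u <= b -> 0 < t + u \/ s < 1/2) ->
  (forall u, Rabs u <= b -> del <= Cmod (zarg t s u - 1)%C) ->
  forall eps, 0 < eps -> exists N0, forall n, (N0 <= n)%nat -> forall u, Rabs u <= b ->
    Cmod (UN n t (hline s u) - Uintegrand t (hline s u))%C < eps.
Proof.
  intros Hs Hdel Hdom Hz eps Heps.
  pose (eta := sin (PI * s / 2)).
  assert (Heta : 0 < eta) by apply (csinh_lower_sin s 0 Hs).
  destruct (Rlt_dec b 0) as [Hb|Hb].
  { exists 0%nat; intros n _ u Hu; pose proof (Rabs_pos u); lra. }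
  pose (V := Rabs t + b).
  assert (HV : 0 <= V) by (unfold V; pose proof (Rabs_pos t); lra).
  pose (aE := exp 2 * (2 + V)); pose (aZ := (3 + V) * (/ del + 2)); pose (aS := 2 / eta).
  pose (Kt := 2 * ((V + 2) + 20 * (V + 2) ^ 2)).
  assert (HaE : 0 < aE) by (apply Rmult_lt_0_compat; [apply exp_pos | lra]).
  assert (Hi := Rinv_0_lt_compat _ Hdel).
  assert (HaZ : 0 < aZ) by (apply Rmult_lt_0_compat; lra).
  assert (HaS : 0 < aS) by (apply Rdiv_lt_0_compat; lra).
  (* With theta error at most e and zeta error at most 2e (3 + V), [UN_error] gives c e. *)
  pose (c := aE * aS * (8 * (3 + V) + 5 * aZ)).
  assert (Hc : 0 < c) by (apply Rmult_lt_0_compat; [apply Rmult_lt_0_compat | ]; lra).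
  pose (e := Rmin (1/2) (eps / c / 2)).
  assert (He : 0 < e) by (apply Rmin_glb_lt; [lra | apply Rdiv_lt_0_compat; [apply Rdiv_lt_0_compat |]; lra]).
  assert (He1 : e <= 1/2) by apply Rmin_l.
  assert (He2 : c * e < eps).
  { apply Rle_lt_trans with (c * (eps / c / 2)); [apply Rmult_le_compat_l; [lra | apply Rmin_r] |].
    replace (c * (eps / c / 2)) with (eps / 2) by (field; lra); lra. }
  destruct (exp_mult_ln_cv (1/2) ltac:(lra) e He) as (A & HA & HAe).
  (* The three summands serve the zeta tail, the validity of the Gauss estimate on a box of size V +
     2, and its rate Kt / n <= e. *)
  destruct (INR_unbounded (A + 2 * (V + 2) + Kt / e)) as [N0 HN0].
  assert (HKt : 0 < Kt) by (unfold Kt; nra).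
  assert (HKe : 0 < Kt / e) by (apply Rdiv_lt_0_compat; assumption).
  exists (S N0); intros n Hn u Hu.
  assert (Hn' : INR N0 <= INR n) by (apply le_INR; lia).
  assert (Hv : Rabs (t + u) <= V) by (unfold V; eapply Rle_trans; [apply Rabs_triang |]; lra).
  assert (Hsh := proj2 (csinh_lower_sin s u Hs)).
  destruct (UN_factor_bounds n t s u del eta ltac:(lia) Hs (Hdom u Hu) Hdel (Hz u Hu) Heta Hsh)
    as (B1 & B2 & B3).
  pose (d := (Ci * RStheta (RtoC t + hline s u) - Ci * thN n (RtoC t + hline s u))%C).
  assert (Hd : Cmod d <= e).
  { eapply Rle_trans; [apply (thN_cv (V + 2)) |]; try lra; try lia.
    - rewrite RtoC_hline; simpl; lra.
    - rewrite RtoC_hline; simpl; rewrite Rabs_Ropp, Rabs_pos_eq; lra.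
    - fold Kt; apply Rle_div_l; [lra |].
      apply Rle_trans with (e * (Kt / e)); [right; field; lra |].
      apply Rmult_le_compat_l; lra. }
  assert (HZ : Cmod (zetaN n (zarg t s u) - zeta (zarg t s u))%C <= (3 + V) * (2 * e)).
  { destruct (zeta_arg_neq t (hline s u) (hline_Udom t s u Hs (Hdom u Hu))) as [N0' N1].
    fold (zarg t s u) in N0', N1.
    assert (HR : Re (zarg t s u) = 1/2 + s) by (rewrite zarg_eq; reflexivity).
    eapply Rle_trans; [apply zetaN_zeta; [rewrite HR; lra | exact N1] |].
    apply Rmult_le_compat; [apply Cmod_ge_0 | | |].
    - rewrite HR; apply Rdiv_le_0_compat; [left; apply exp_pos | lra].
    - eapply Rle_trans; [apply Cmod_le_abs |]; rewrite zarg_eq; simpl.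
      rewrite (Rabs_pos_eq (1/2 + s)) by lra; lra.
    - rewrite HR; apply Rle_div_l; [lra |].
      assert (L : ln A <= ln (INR (S n))) by (apply ln_le; [lra | rewrite S_INR; lra]).
      assert (L0 : 0 <= ln A) by (rewrite <- ln_1; apply ln_le; lra).
      assert (exp (- (1/2 + s) * ln (INR (S n))) <= exp (- (1/2) * ln A)) by (apply exp_le; nra).
      nra. }
  assert (E : Uintegrand t (hline s u) =
    (cexp (Ci * thN n (RtoC t + hline s u) - Ci * RStheta (RtoC t)) * cexp d
      * zeta (zarg t s u) * (RtoC PI / (RtoC 2 * csinh (RtoC PI * hline s u / RtoC 2))))%C).
  { rewrite <- cexp_plus; unfold Uintegrand; fold (zarg t s u).
    do 3 f_equal; unfold d; ring. }
  rewrite E; unfold UN; fold (zarg t s u).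
  eapply Rle_lt_trans; [| exact He2].
  eapply Rle_trans; [apply (UN_error _ _ _ _ d aE aZ aS ((3 + V) * (2 * e))) |].
  - lra.
  - eapply Rle_trans; [exact B1 |]; apply Rmult_le_compat_l; [left; apply exp_pos | lra].
  - eapply Rle_trans; [exact B2 |]; apply Rmult_le_compat_r; lra.
  - exact B3.
  - exact HZ.
  - unfold c; rewrite (Rmult_assoc (aE * aS) _ e); apply Rmult_le_compat_l; [left; apply Rmult_lt_0_compat; assumption |].
    assert (aZ * Cmod d <= aZ * e) by (apply Rmult_le_compat_l; lra); lra.
Qed.

(** Uniform convergence also yields integrability of [Uintegrand], whose continuity is never
    established directly. *)
Lemma UN_RInt_cv (t s b del : R) : 0 <= b -> 0 < s < 2 -> 0 < del ->
  (forall u, Rabs u <= b -> 0 < t + u \/ s < 1/2) ->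
  (forall u, Rabs u <= b -> del <= Cmod (zarg t s u - 1)%C) ->
  exists (J : nat -> C) (I : C),
    (forall n, is_RIntC (fun u => UN n t (hline s u)) (- b) b (J n)) /\
    is_RIntC (fun u => Uintegrand t (hline s u)) (- b) b I /\
    (forall eps, 0 < eps -> exists N0, forall n, (N0 <= n)%nat -> Cmod (J n - I)%C < eps).
Proof.
  intros Hb Hs Hdel Hdom Hz.
  assert (Hex : forall n, ex_RIntC (fun u => UN n t (hline s u)) (- b) b).
  { intros n; apply (ex_RInt_continuous (V:=C_R_CompleteNormedModule)); intros u Hu.
    rewrite Rmin_left, Rmax_right in Hu by lra.
    apply (hol_continuous_line (Udom t)); [apply hol_UN | apply hline_Udom; [exact Hs |]].
    apply Hdom, Rabs_le, Hu. }
  (* [filterlim_RInt] asks for uniform convergence on the whole real line, so the functions are set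
     to 0 off the segment. *)
  pose (cut (f : R -> C) (u : R) := if Rle_dec (Rabs u) b then f u else RtoC 0).
  assert (Hcut : forall f (u : R), Rmin (- b) b < u < Rmax (- b) b -> f u = cut f u).
  { intros f u Hu; rewrite Rmin_left, Rmax_right in Hu by lra; unfold cut.
    destruct (Rle_dec (Rabs u) b) as [_|H]; [reflexivity | exfalso; apply H, Rabs_le; lra]. }
  pose (J n := RIntC (fun u => UN n t (hline s u)) (- b) b : C).
  destruct (filterlim_RInt (V:=C_R_CompleteNormedModule)
    (fun n => cut (fun u => UN n t (hline s u))) (- b) b eventually _
    (cut (fun u => Uintegrand t (hline s u))) J) as (I & HJ & HI).
  - intros n; apply (is_RInt_ext (V:=C_R_NormedModule) (fun u => UN n t (hline s u))).
    + apply Hcut.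
    + apply (RInt_correct (V:=C_R_CompleteNormedModule)), Hex.
  - apply filterlim_locally; intros eps.
    destruct (UN_uniform t s b del Hs Hdel Hdom Hz eps (cond_pos eps)) as [N0 HN].
    exists N0; intros n Hn u; unfold cut.
    destruct (Rle_dec (Rabs u) b) as [H|H]; [| apply ball_center].
    apply ball_C_Cmod, HN; assumption.
  - exists J, I; split; [| split].
    + intros n; apply (RInt_correct (V:=C_R_CompleteNormedModule)), Hex.
    + apply (is_RInt_ext (V:=C_R_NormedModule) (cut (fun u => Uintegrand t (hline s u)))); [| exact HI].
      intros u Hu; symmetry; exact (Hcut (fun u => Uintegrand t (hline s u)) u Hu).
    + intros eps Heps.
      assert (He : 0 < eps / 2) by lra.
      destruct (proj1 (filterlim_locally J I) HJ (mkposreal _ He)) as [N0 HN].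
      exists N0; intros n Hn; specialize (HN n Hn); apply Cmod_ball_C in HN; simpl in HN; lra.
Qed.

(** * Tails and conclusion *)

Lemma zarg_quarter t u : 1/4 <= Cmod (zarg t (1/4) u - 1)%C.
Proof.
  eapply Rle_trans; [| apply re_le_Cmod]; rewrite zarg_eq; simpl.
  rewrite Rabs_left; lra.
Qed.

Lemma zarg_im t s u : Rabs (t + u) <= Cmod (zarg t s u - 1)%C.
Proof.
  eapply Rle_trans; [| apply im_le_Cmod]; rewrite zarg_eq; simpl.
  right; f_equal; ring.
Qed.

Lemma Uintegrand_decay (t u : R) : 3 <= t -> 1 <= Rabs u ->
  Cmod (Uintegrand t (hline (1/4) u)) <= 768 * exp 2 * t ^ 2 * exp (- (Rabs u / 2)).
Proof.
  intros Ht Hu; apply le_epsilon; intros e He.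
  destruct (UN_uniform t (1/4) (Rabs u) (1/4)) with (eps := e) as [N0 HN]; try lra.
  - intros v _; right; lra.
  - intros v _; apply zarg_quarter.
  - specialize (HN (S N0) ltac:(lia) u (Rle_refl _)).
    assert (D := UN_decay (S N0) t (1/4) u ltac:(lia) Ht Hu ltac:(lra) ltac:(right; lra) (zarg_quarter t u)).
    replace (Uintegrand t (hline (1/4) u))
      with (UN (S N0) t (hline (1/4) u) + - (UN (S N0) t (hline (1/4) u) - Uintegrand t (hline (1/4) u)))%C by ring.
    eapply Rle_trans; [apply Cmod_triangle |]; rewrite Cmod_opp; lra.
Qed.

Lemma ex_RInt_Uintegrand (t a b : R) : ex_RIntC (fun u => Uintegrand t (hline (1/4) u)) a b.
Proof.
  assert (Q : forall c, 0 <= c -> ex_RIntC (fun u => Uintegrand t (hline (1/4) u)) (- c) c).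
  { intros c Hc; destruct (UN_RInt_cv t (1/4) c (1/4)) as (J & I & _ & HI & _); try lra.
    - intros u _; right; lra.
    - intros u _; apply zarg_quarter.
    - exists I; exact HI. }
  set (c := Rabs a + Rabs b).
  assert (Ha := Rabs_pos a); assert (Hb := Rabs_pos b).
  assert (Ha' := proj1 (Rabs_le_between a _) (Rle_refl _)).
  assert (Hb' := proj1 (Rabs_le_between b _) (Rle_refl _)).
  apply (ex_RInt_Chasles (V:=C_R_NormedModule) _ a (- c) b).
  - apply ex_RInt_swap, (ex_RInt_Chasles_1 (V:=C_R_CompleteNormedModule) _ (- c) a c); [unfold c; lra | apply Q; unfold c; lra].
  - apply (ex_RInt_Chasles_1 (V:=C_R_CompleteNormedModule) _ (- c) b c); [unfold c; lra | apply Q; unfold c; lra].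
Qed.

Lemma RInt_exp_decay_right (f : R -> C) (K a b : R) : a <= b -> ex_RIntC f a b -> 0 <= K ->
  (forall u, a <= u <= b -> Cmod (f u) <= K * exp (- (u / 2))) ->
  Cmod (RIntC f a b) <= 2 * K * exp (- (a / 2)).
Proof.
  intros Hab Hex HK Hf; rewrite <- norm_C_R.
  apply Rle_trans with (minus (- 2 * K * exp (- (b / 2))) (- 2 * K * exp (- (a / 2)))).
  - apply (norm_RInt_le (V:=C_R_NormedModule) f (fun u => K * exp (- (u / 2))) a b); [exact Hab | | |].
    + intros u Hu; rewrite norm_C_R; apply Hf, Hu.
    + apply (RInt_correct (V:=C_R_CompleteNormedModule)), Hex.
    + apply (is_RInt_derive (V:=R_CompleteNormedModule) (fun u => - 2 * K * exp (- (u / 2))));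
        intros u _.
      * eapply is_derive_val; [auto_derive; [auto | reflexivity] | unfold Rdiv; simpl; field].
      * apply (ex_derive_continuous (V:=R_NormedModule)); auto_derive; auto.
  - unfold minus, plus, opp; simpl.
    assert (0 <= K * exp (- (b / 2))) by (apply Rmult_le_pos; [exact HK | left; apply exp_pos]); lra.
Qed.

Lemma RInt_exp_decay_left (f : R -> C) (K a b : R) : a <= b -> ex_RIntC f a b -> 0 <= K ->
  (forall u, a <= u <= b -> Cmod (f u) <= K * exp (u / 2)) ->
  Cmod (RIntC f a b) <= 2 * K * exp (b / 2).
Proof.
  intros Hab Hex HK Hf; rewrite <- norm_C_R.
  apply Rle_trans with (minus (2 * K * exp (b / 2)) (2 * K * exp (a / 2))).
  - apply (norm_RInt_le (V:=C_R_NormedModule) f (fun u => K * exp (u / 2)) a b); [exact Hab | | |].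
    + intros u Hu; rewrite norm_C_R; apply Hf, Hu.
    + apply (RInt_correct (V:=C_R_CompleteNormedModule)), Hex.
    + apply (is_RInt_derive (V:=R_CompleteNormedModule) (fun u => 2 * K * exp (u / 2)));
        intros u _.
      * eapply is_derive_val; [auto_derive; [auto | reflexivity] | unfold Rdiv; simpl; field].
      * apply (ex_derive_continuous (V:=R_NormedModule)); auto_derive; auto.
  - unfold minus, plus, opp; simpl.
    assert (0 <= K * exp (a / 2)) by (apply Rmult_le_pos; [exact HK | left; apply exp_pos]); lra.
Qed.

Lemma Uline_tail (t b a' b' : R) : 3 <= t -> 1 <= b -> a' <= - b -> b <= b' ->
  Cmod (RIntC (fun u => Uintegrand t (hline (1/4) u)) a' b'
        - RIntC (fun u => Uintegrand t (hline (1/4) u)) (- b) b)%C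
  <= 4 * (768 * exp 2 * t ^ 2) * exp (- (b / 2)).
Proof.
  intros Ht Hb Ha' Hb'; set (f := fun u => Uintegrand t (hline (1/4) u)).
  assert (Hex : forall x y, ex_RIntC f x y) by exact (ex_RInt_Uintegrand t).
  rewrite (RIntC_Chasles f a' (- b) b'), (RIntC_Chasles f (- b) b b') by apply Hex.
  assert (HK : 0 <= 768 * exp 2 * t ^ 2).
  { apply Rmult_le_pos; [pose proof (exp_pos 2); lra | apply pow2_ge_0]. }
  assert (D1 : Cmod (RIntC f a' (- b)) <= 2 * (768 * exp 2 * t ^ 2) * exp (- b / 2)).
  { apply RInt_exp_decay_left; auto; intros u Hu.
    assert (Eu : Rabs u = - u) by (apply Rabs_left; lra).
    assert (D := Uintegrand_decay t u Ht); rewrite Eu in D.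
    replace (u / 2) with (- (- u / 2)) by field; apply D; lra. }
  assert (D2 : Cmod (RIntC f b b') <= 2 * (768 * exp 2 * t ^ 2) * exp (- (b / 2))).
  { apply RInt_exp_decay_right; auto; intros u Hu.
    assert (Eu : Rabs u = u) by (apply Rabs_pos_eq; lra).
    assert (D := Uintegrand_decay t u Ht); rewrite Eu in D; apply D; lra. }
  replace (- b / 2) with (- (b / 2)) in D1 by field.
  set (x := RIntC f a' (- b)) in *; set (y := RIntC f (- b) b); set (z := RIntC f b b') in *.
  assert (E : (x + (y + z) - y)%C = (x + z)%C) by (apply C_eq; simpl; ring).
  rewrite E; eapply Rle_trans; [apply Cmod_triangle |]; lra.
Qed.

Lemma Uline_truncation (t b : R) : 3 <= t -> 1 <= b ->
  Cmod (@RInt_gen C_R_CompleteNormedModule (fun u => Uintegrand t (hline (1/4) u))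
          (Rbar_locally m_infty) (Rbar_locally p_infty)
        - RIntC (fun u => Uintegrand t (hline (1/4) u)) (- b) b)%C
  <= 4 * (768 * exp 2 * t ^ 2) * exp (- (b / 2)).
Proof.
  intros Ht Hb.
  assert (Q : forall M, filter_prod (Rbar_locally m_infty) (Rbar_locally p_infty)
     (fun ab => fst ab < - M /\ M < snd ab)).
  { intros M; apply (Filter_prod _ _ _ (fun a => a < - M) (fun b => M < b)).
    - exists (- M); auto.
    - exists M; auto.
    - intros x y Hx Hy; simpl; auto. }
  apply (RInt_gen_approx (fun u => Uintegrand t (hline (1/4) u)) (Rbar_locally m_infty) (Rbar_locally p_infty)).
  - generalize (Q 0); apply filter_imp; intros [x y] _; exact (ex_RInt_Uintegrand t x y).
  - intros eps.
    set (K := 4 * (768 * exp 2 * t ^ 2)).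
    assert (HK : 0 < K).
    { unfold K; apply Rmult_lt_0_compat; [lra |]; apply Rmult_lt_0_compat; [pose proof (exp_pos 2); lra | nra]. }
    assert (Heps := cond_pos eps).
    destruct (exp_mult_ln_cv (1/2) ltac:(lra) (eps / K)) as (A & HA & HAe).
    { apply Rdiv_lt_0_compat; assumption. }
    (* [Uline_tail] needs M >= 1, and M >= ln A makes exp(-M/2) small. *)
    pose (M := Rmax 1 (ln A)).
    assert (HM1 : 1 <= M) by apply Rmax_l; assert (HM2 : ln A <= M) by apply Rmax_r.
    exists (RIntC (fun u => Uintegrand t (hline (1/4) u)) (- M) M).
    generalize (Q M); apply filter_imp; intros [x y] [Hx Hy]; simpl in Hx, Hy |- *.
    eapply Rle_lt_trans; [apply Uline_tail; lra |]; fold K.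
    assert (exp (- (M / 2)) <= exp (- (1/2) * ln A)) by (apply exp_le; lra).
    apply Rle_lt_trans with (K * exp (- (1/2) * ln A)); [apply Rmult_le_compat_l; lra |].
    apply Rlt_div_r in HAe; [| exact HK]; lra.
  - generalize (Q b); apply filter_imp; intros [x y] [Hx Hy]; simpl in Hx, Hy |- *.
    apply Uline_tail; lra.
Qed.

(** [b + 1 <= t] keeps t + Re x >= 1, away from the cuts and the pole of zeta at every depth. The 8
    is the 4 of [hol_shift] times |s0 - 1/4| <= 2. *)
Lemma Useg_shift (t b s0 : R) (I1 I0 : C) : 3 <= t -> 1 <= b -> b + 1 <= t -> 0 < s0 < 2 ->
  is_RIntC (fun u => Uintegrand t (hline (1/4) u)) (- b) b I1 ->
  is_RIntC (fun u => Uintegrand t (hline s0 u)) (- b) b I0 ->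
  Cmod (I0 - I1)%C <= 8 * (768 * exp 2 * t ^ 2 * exp (- (b / 2))).
Proof.
  intros Ht Hb Hbt Hs0 H1 H0.
  assert (Hdom : forall s u, Rabs u <= b -> 0 < t + u \/ s < 1/2).
  { intros s u Hu; apply Rabs_le_between in Hu; left; lra. }
  assert (Hz : forall s u, Rabs u <= b -> 1/4 <= Cmod (zarg t s u - 1)%C).
  { intros s u Hu; eapply Rle_trans; [| apply zarg_im].
    apply Rabs_le_between in Hu; rewrite Rabs_pos_eq; lra. }
  destruct (UN_RInt_cv t (1/4) b (1/4)) as (J1 & I1' & HJ1 & HI1 & L1); auto; try lra.
  destruct (UN_RInt_cv t s0 b (1/4)) as (J0 & I0' & HJ0 & HI0 & L0); auto; try lra.
  assert (E1 : I1' = I1) by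
    (exact (eq_trans (eq_sym (is_RInt_unique (V:=C_R_CompleteNormedModule) _ _ _ _ HI1)) (is_RInt_unique (V:=C_R_CompleteNormedModule) _ _ _ _ H1))).
  assert (E0 : I0' = I0) by
    (exact (eq_trans (eq_sym (is_RInt_unique (V:=C_R_CompleteNormedModule) _ _ _ _ HI0)) (is_RInt_unique (V:=C_R_CompleteNormedModule) _ _ _ _ H0))).
  subst I1' I0'.
  set (M := 768 * exp 2 * t ^ 2 * exp (- (b / 2))).
  assert (HM : 0 <= M).
  { unfold M; repeat apply Rmult_le_pos; try lra; left; apply exp_pos. }
  apply le_epsilon; intros e He.
  destruct (L1 (e / 2) ltac:(lra)) as [N1 HN1]; destruct (L0 (e / 2) ltac:(lra)) as [N0 HN0].
  pose (n := S (N0 + N1)).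
  assert (S : Cmod (J0 n - J1 n)%C <= 4 * M * Rabs (s0 - 1/4)).
  { apply (hol_shift (Udom t) (UN n t) (- t) (- b) b (b + 1) 0 2 M (1/4) s0); try lra.
    - intros s u Hs Hu; apply hline_Udom; [exact Hs | left; lra].
    - apply hol_UN.
    - intros s Hs.
      assert (Hs' : 0 < s < 2).
      { destruct Hs as [A B]; split.
        - eapply Rlt_le_trans; [| exact A]; apply Rmin_glb_lt; lra.
        - eapply Rle_lt_trans; [exact B |]; apply Rmax_lub_lt; lra. }
      assert (Eb : Rabs b = b) by (apply Rabs_pos_eq; lra).
      split.
      + unfold M; rewrite <- Eb at 2; rewrite <- (Rabs_Ropp b).
        apply UN_decay; auto; try (unfold n; lia); try (apply Hdom || apply Hz); rewrite Rabs_Ropp, Eb; lra.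
      + unfold M; rewrite <- Eb at 2.
        apply UN_decay; auto; try (unfold n; lia); try (apply Hdom || apply Hz); rewrite Eb; lra.
    - apply HJ1.
    - apply HJ0. }
  assert (Rabs (s0 - 1/4) <= 2) by (apply Rabs_le; lra).
  specialize (HN1 n ltac:(unfold n; lia)); specialize (HN0 n ltac:(unfold n; lia)).
  eapply Rle_trans; [apply (Cmod_minus_triangle _ (J0 n)) |].
  eapply Rle_trans; [apply Rplus_le_compat_l, (Cmod_minus_triangle _ (J1 n)) |].
  rewrite (Cmod_minus_sym I0).
  assert (4 * M * Rabs (s0 - 1/4) <= 4 * M * 2) by (apply Rmult_le_compat_l; lra).
  lra.
Qed.

(** ln t = 2 ln (sqrt t) <= 2 (sqrt t - 1), and sqrt t >= 2 C0 + 2 absorbs the factor 2 C0. *)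
Lemma log_window (C0 t : R) : 1 <= C0 -> (2 * C0 + 2) ^ 2 <= t -> C0 * ln t + 1 <= t.
Proof.
  intros HC Ht.
  assert (Ht0 : 0 < t) by nra.
  assert (Hs : 2 * C0 + 2 <= sqrt t).
  { rewrite <- (sqrt_pow2 (2 * C0 + 2)) by lra; apply sqrt_le_1_alt, Ht. }
  assert (Hq := sqrt_sqrt t (Rlt_le _ _ Ht0)).
  assert (L : ln t <= 2 * (sqrt t - 1)).
  { rewrite <- Hq at 1; rewrite ln_mult by lra.
    pose proof (ln_le_sub1 (sqrt t) ltac:(lra)); lra. }
  nra.
Qed.

Theorem mainTheorem2 (n : nat) (sigma0 : R) (Hs : 0 < sigma0 < 2) :
  exists C0 : R, 0 < C0 /\
  exists K T0 : R, 0 < K /\ 0 < T0 /\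
    forall t : R, T0 <= t ->
      Cmod (U t - Useg sigma0 (C0 * ln t) t)%C <= K * / (t ^ n).
Proof.
  set (C0 := 2 * INR (n + 2)).
  assert (HC0 : 4 <= C0).
  { unfold C0; rewrite plus_INR; simpl; pose proof (pos_INR n); lra. }
  exists C0; split; [lra |].
  (* 12 = 4 + 8, from truncating the line and shifting the segment; the threshold on [t] is that of
     [log_window]. *)
  exists (12 * (768 * exp 2)), ((2 * C0 + 2) ^ 2).
  assert (He2 := exp_pos 2).
  split; [lra |]; split; [nra |]; intros t HT.
  assert (Ht : 3 <= t) by nra.
  set (b := C0 * ln t).
  assert (Hbt : b + 1 <= t) by (apply log_window; lra).
  assert (Hb : 1 <= b).
  { unfold b; pose proof (ln_ge_1_inv t ltac:(lra)).
    assert (/ t <= / 3) by (apply Rinv_le_contravar; lra); nra. }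
  assert (Hexp : exp (- (b / 2)) = / t ^ n * / t ^ 2).
  { unfold b, C0; replace (- (2 * INR (n + 2) * ln t / 2)) with (- (INR (n + 2) * ln t)) by field.
    rewrite exp_Ropp, <- Rinv_mult, <- pow_add; f_equal.
    apply (Rpower_pow (n + 2) t); lra. }
  destruct (UN_RInt_cv t sigma0 b (1/4)) as (J & I0 & _ & HI0 & _); auto; try lra.
  { intros u Hu; apply Rabs_le_between in Hu; left; lra. }
  { intros u Hu; eapply Rle_trans; [| apply zarg_im].
    apply Rabs_le_between in Hu; rewrite Rabs_pos_eq; lra. }
  assert (HI1 := RInt_correct (V:=C_R_CompleteNormedModule) _ _ _ (ex_RInt_Uintegrand t (- b) b)).
  assert (A := Useg_shift t b sigma0 _ I0 Ht Hb Hbt Hs HI1 HI0).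
  assert (B := Uline_truncation t b Ht Hb).
  assert (E0 : Useg sigma0 b t = (/ (RtoC (2 * PI) * Ci) * I0)%C).
  { unfold Useg; f_equal; exact (is_RInt_unique (V:=C_R_CompleteNormedModule) _ _ _ _ HI0). }
  rewrite E0; unfold U, Uline.
  change (fun u : R => Uintegrand t (RtoC u - Ci * RtoC (1/4))%C)
    with (fun u : R => Uintegrand t (hline (1/4) u)).
  set (G := @RInt_gen C_R_CompleteNormedModule _ _ _) in *.
  set (I1 := RIntC _ _ _) in *.
  assert (HP := PI2_3_2).
  assert (Hpre : Cmod (/ (RtoC (2 * PI) * Ci))%C <= 1).
  { assert (N : (RtoC (2 * PI) * Ci)%C <> 0%C).
    { apply Cmult_neq_0; [intro E; apply (f_equal fst) in E; simpl in E; lra | apply Ci_neq0]. }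
    rewrite Cmod_inv by exact N; rewrite Cmod_mult, Cmod_Ci, Cmod_R, Rabs_pos_eq by lra.
    rewrite Rmult_1_r, <- Rinv_1; apply Rinv_le_contravar; lra. }
  assert (E : (/ (RtoC (2 * PI) * Ci) * G - / (RtoC (2 * PI) * Ci) * I0)%C
     = (/ (RtoC (2 * PI) * Ci) * (G - I0))%C) by (unfold Cminus; rewrite Cmult_plus_distr_l; f_equal; ring).
  rewrite E, Cmod_mult.
  assert (T := Cmod_minus_triangle G I1 I0); rewrite (Cmod_minus_sym I1 I0) in T.
  apply Rle_trans with (1 * Cmod (G - I0)%C); [apply Rmult_le_compat_r; [apply Cmod_ge_0 | exact Hpre] |].
  rewrite Rmult_1_l; eapply Rle_trans; [exact T |].
  eapply Rle_trans; [apply Rplus_le_compat; [exact B | exact A] |].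
  rewrite Hexp; right; field; split; [apply pow_nonzero |]; lra.
Qed.
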